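(* Let $\{\mu_t\}_{t\ge0}$ be a weakly continuous $\rhd$-convolution semigroup with $\mu_0=\delta_0$ and associated pair $(\gamma,\tau)$, and let $n\ge1$ be an integer. The following are equivalent: (1) there exists $t_0>0$ such that $\int_{\mathbb{R}}x^{2n}\mu_{t_0}(dx)<\infty$; (2) $\int_{\mathbb{R}}x^{2n}\mu_t(dx)<\infty$ for all $0<t<\infty$; (3) $\int_{\mathbb{R}}x^{2n}\tau(dx)<\infty$.
   Context: For a probability measure $\mu$, $G_\mu(z)=\int\frac{1}{z-x}d\mu(x)$ on $\mathbb{C}^+$ and $H_\mu=1/G_\mu$; $\mu\rhd\nu$ is the unique probability measure with $H_{\mu\rhd\nu}=H_\mu\circ H_\nu$. A weakly continuous $\rhd$-convolution semigroup is a weakly continuous family $\{\mu_t\}_{t\ge0}$ of probability measures with $\mu_s\rhd\mu_t=\mu_{s+t}$. For such a semigroup with $\mu_0=\delta_0$ there is a unique pair $(\gamma,\tau)$, $\gamma\in\mathbb{R}$, $\tau$ positive finite, such that with $A(z)=-\gamma+\int\frac{1+xz}{x-z}d\tau(x)$ the maps $H_t:=H_{\mu_t}$ solve $\frac{d}{dt}H_t(z)=A(H_t(z))$, $H_0(z)=z$, on $\mathbb{C}\setminus\mathbb{R}$ (the associated pair). *)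

(* Defs.v *)
From HB Require Import structures.
From mathcomp Require Import all_boot all_order all_algebra.
From mathcomp Require Import all_classical all_reals all_analysis.
From mathcomp Require Import complex.
Set Implicit Arguments. Unset Strict Implicit. Unset Printing Implicit Defensive.
Import Order.TTheory GRing.Theory Num.Theory.
Import numFieldNormedType.Exports.
Local Open Scope classical_set_scope.
Local Open Scope ring_scope.
Local Open Scope complex_scope.

Section MonotoneDefs.
Variable R : realType.

Definition cintegral (mu : {measure set R -> \bar R}) (f : R -> R[i]) : R[i] :=
  (Rintegral mu setT (fun x => complex.Re (f x))) +i* (Rintegral mu setT (fun x => complex.Im (f x))).

Definition cauchyG (mu : probability R R) (z : R[i]) : R[i] :=
  cintegral mu (fun x => (z - x%:C)^-1).

Definition cauchyH (mu : probability R R) (z : R[i]) : R[i] := (cauchyG mu z)^-1.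

Definition weakly_continuous (mu : R -> probability R R) : Prop :=
  forall f : R -> R, continuous f -> (exists M : R, forall x, `|f x| <= M) ->
    {within [set t : R | 0 <= t], continuous (fun t => Rintegral (mu t) setT f)}.

(* mu_s |> mu_t = mu_(s+t), where |> is characterized by H_{mu |> nu} = H_mu o H_nu on C^+ *)
Definition monotone_semigroup (mu : R -> probability R R) : Prop :=
  forall s t : R, 0 <= s -> 0 <= t ->
    forall z : R[i], 0 < complex.Im z ->
      cauchyH (mu (s + t)) z = cauchyH (mu s) (cauchyH (mu t) z).

Definition generatorA (gamma : R) (tau : {finite_measure set R -> \bar R}) (z : R[i]) : R[i] :=
  - gamma%:C + cintegral tau (fun x => (1 + x%:C * z) / (x%:C - z)).

(* (gamma, tau) is the associated pair: d/dt H_t(z) = A(H_t(z)) on C \ R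
   (H_0(z) = z holds automatically since mu_0 = delta_0). The complex derivative in
   the real variable t is expressed through real and imaginary parts. *)
Definition associated_pair (mu : R -> probability R R) (gamma : R)
    (tau : {finite_measure set R -> \bar R}) : Prop :=
  forall z : R[i], complex.Im z != 0 -> forall t : R, 0 < t ->
    is_derive t 1 (fun s => complex.Re (cauchyH (mu s) z)) (complex.Re (generatorA gamma tau (cauchyH (mu t) z)))
 /\ is_derive t 1 (fun s => complex.Im (cauchyH (mu s) z)) (complex.Im (generatorA gamma tau (cauchyH (mu t) z))).

End MonotoneDefs.

(* Main.v *)
Require Import Defs.
From HB Require Import structures.
From mathcomp Require Import all_boot all_order all_algebra.
From mathcomp Require Import all_classical all_reals all_analysis.
From mathcomp Require Import measurable_realfun complex ring lra.
Import Order.TTheory GRing.Theory Num.Theory.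
Import numFieldNormedType.Exports.
Local Open Scope classical_set_scope.
Local Open Scope ring_scope.
Set Implicit Arguments. Unset Strict Implicit. Unset Printing Implicit Defensive.

(** The Hamburger-Nevanlinna principle, along z = iy with y large: a probability
    measure has a finite moment of order 2n iff its reciprocal Cauchy transform H satisfies
    H(z) - z = real polynomial in 1/z + O(y^-(2n-1)). The moment is recovered because the real
    part of z^(N+2) times the first remainder is the integral of a positive truncated kernel,
    so it is bounded only if the next even moment is finite.

    If tau has a moment of order 2n, then A(w) = P(1/w) + O((Im w)^-(2n-1)) with P real;
    since Im H_t(z) >= Im z, integrating dH/dt = A(H) bootstraps an expansion of H_t(z) - z, whose
    coefficients are real polynomials in t, up to order 2n - 1.

    Conversely, let mu_t0 have a moment of order 2n, and assume inductively that tau has one of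
    order 2n - 2. Then A(w) = P(1/w) - w^-N K(w) with N = 2n - 3 and K(w) the integral of
    x^(2n-3) (1 + x^2) / (w - x), and H_t - z minus the contribution of P has, at t = t0, a
    real expansion to order N + 2. The real part of z^(N+2) H_s^-N K(H_s) bounds the truncated
    moment of order 2n from above, uniformly in s, because H_s = z + O(1). For n = 1 the same
    argument uses Im A and only needs |H_s(iy)| <= 2y for small s, which follows from weak
    continuity at 0. *)

(** * Modulus, real and imaginary parts *)

Section ComplexNorm.
Variable R : realType.
Implicit Types z w : R[i].
Local Notation nc := (@Normc.normc R).

Lemma nc_def z : nc z = Num.sqrt (complex.Re z ^+ 2 + complex.Im z ^+ 2).
Proof. by case: z. Qed.

Lemma nc_ge0 z : 0 <= nc z. Proof. by rewrite nc_def sqrtr_ge0. Qed.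

Lemma nc_sqr z : nc z ^+ 2 = complex.Re z ^+ 2 + complex.Im z ^+ 2.
Proof. by rewrite nc_def sqr_sqrtr// addr_ge0// sqr_ge0. Qed.

Lemma ncM z w : nc (z * w) = nc z * nc w. Proof. exact: Normc.normcM. Qed.
Lemma ncV z : nc z^-1 = (nc z)^-1. Proof. exact: Normc.normcV. Qed.
Lemma nc0 : nc 0 = 0. Proof. exact: Normc.normc0. Qed.
Lemma nc1 : nc 1 = 1. Proof. exact: Normc.normc1. Qed.
Lemma ncX z n : nc (z ^+ n) = nc z ^+ n.
Proof. by elim: n => [|n ih]; rewrite ?expr0 ?nc1// !exprS ncM ih. Qed.
Lemma ncN z : nc (- z) = nc z. Proof. exact: normcN. Qed.
Lemma ncD z w : nc (z + w) <= nc z + nc w. Proof. exact: le_normcD. Qed.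
Lemma ncB z w : nc (z - w) <= nc z + nc w.
Proof. by rewrite (le_trans (ncD _ _))// ncN. Qed.

Lemma nc_real (x : R) : nc (real_complex R x) = `|x|.
Proof. by rewrite nc_def/= expr0n addr0 sqrtr_sqr. Qed.

Lemma nc_ge_Re z : `|complex.Re z| <= nc z.
Proof.
by rewrite nc_def -sqrtr_sqr ler_wsqrtr// lerDl sqr_ge0.
Qed.

Lemma nc_ge_Im z : `|complex.Im z| <= nc z.
Proof.
by rewrite nc_def -sqrtr_sqr ler_wsqrtr// lerDr sqr_ge0.
Qed.

Lemma nc_le_ReIm z : nc z <= `|complex.Re z| + `|complex.Im z|.
Proof.
rewrite -(@ler_pXn2r _ 2)// ?nnegrE ?nc_ge0 ?addr_ge0//.
rewrite nc_sqr sqrrD !real_normK ?num_real//.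
have := mulr_ge0 (normr_ge0 (complex.Re z)) (normr_ge0 (complex.Im z)).
by rewrite mulr2n; lra.
Qed.

Lemma cReD z w : complex.Re (z + w) = complex.Re z + complex.Re w.
Proof. by case: z w => ? ? []. Qed.
Lemma cImD z w : complex.Im (z + w) = complex.Im z + complex.Im w.
Proof. by case: z w => ? ? []. Qed.
Lemma cReN z : complex.Re (- z) = - complex.Re z. Proof. by case: z. Qed.
Lemma cImN z : complex.Im (- z) = - complex.Im z. Proof. by case: z. Qed.
Lemma cReM z w : complex.Re (z * w) =
  complex.Re z * complex.Re w - complex.Im z * complex.Im w.
Proof. by case: z w => ? ? []. Qed.
Lemma cImM z w : complex.Im (z * w) =
  complex.Re z * complex.Im w + complex.Im z * complex.Re w.
Proof. by case: z w => ? ? []. Qed.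
Lemma cReV z : complex.Re z^-1 =
  complex.Re z / (complex.Re z ^+ 2 + complex.Im z ^+ 2).
Proof. by case: z. Qed.
Lemma cImV z : complex.Im z^-1 =
  - complex.Im z / (complex.Re z ^+ 2 + complex.Im z ^+ 2).
Proof. by case: z => a b; rewrite /= mulNr. Qed.

Lemma nc_eq0 z : (nc z == 0) = (z == 0).
Proof.
by apply/eqP/eqP => [/Normc.eq0_normc//|->]; rewrite nc0.
Qed.

Lemma nc_gt0 z : (0 < nc z) = (z != 0).
Proof. by rewrite lt0r nc_eq0 nc_ge0 andbT. Qed.

End ComplexNorm.

(** * Uniform real expansions along the imaginary axis *)

Section Expansion.
Variables (R : realType) (T : R).
Local Notation nc := (@Normc.normc R).

Definition iy (y : R) : R[i] := Complex 0 y.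

Lemma nc_iy y : 0 <= y -> nc (iy y) = y.
Proof. by move=> y0; rewrite /= expr0n add0r sqrtr_sqr ger0_norm. Qed.

Lemma iy_neq0 y : 0 < y -> iy y != 0.
Proof. by move=> y0; rewrite -nc_gt0 nc_iy// ltW. Qed.

Lemma nc_iyV y : 0 <= y -> nc (iy y)^-1 = y^-1.
Proof. by move=> y0; rewrite ncV nc_iy. Qed.

(** The inner polynomials are coefficients depending on the time s; the outer indeterminate stands
    for 1/(iy). Realness of the coefficients is built into the type, and it is what the moment
    arguments exploit. *)
Definition ev (p : {poly {poly R}}) (s : R) (u : R[i]) : R[i] :=
  (map_poly (real_complex R \o horner_eval s) p).[u].

Lemma evD p q s u : ev (p + q) s u = ev p s u + ev q s u.
Proof. by rewrite /ev rmorphD/= hornerD. Qed.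
Lemma evN p s u : ev (- p) s u = - ev p s u.
Proof. by rewrite /ev rmorphN/= hornerN. Qed.
Lemma evM p q s u : ev (p * q) s u = ev p s u * ev q s u.
Proof. by rewrite /ev rmorphM/= hornerM. Qed.
Lemma ev1 s u : ev 1 s u = 1.
Proof. by rewrite /ev rmorph1 hornerC. Qed.
Lemma evX s u : ev 'X s u = u.
Proof. by rewrite /ev map_polyX hornerX. Qed.
Lemma evC c s u : ev c%:P s u = real_complex R c.[s].
Proof. by rewrite /ev map_polyC hornerC. Qed.

(* A real asymptotic expansion of F(s, iy) in powers of 1/(iy), with an error
   O(y^-k) uniform for s in [0, T]; its coefficients are real polynomials in s. *)
Definition expands k (F : R -> R -> R[i]) := exists p C, forall s y,
  0 <= s <= T -> 1 <= y -> nc (F s y - ev p s (iy y)^-1) <= C * y^-1 ^+ k.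

Lemma poly_bounded (c : {poly R}) :
  exists2 C, 0 <= C & forall s, 0 <= s <= T -> `|c.[s]| <= C.
Proof.
elim/poly_ind: c => [|p c [C C0 hC]].
  by exists 0 => // s _; rewrite horner0 normr0.
exists (C * `|T| + `|c|); first by rewrite addr_ge0// mulr_ge0.
move=> s /[dup] sT /andP[s0 sT']; rewrite hornerMXaddC (le_trans (ler_normD _ _))//.
rewrite lerD2r normrM ler_pM// ?hC// ger0_norm//.
by rewrite (le_trans sT')// ler_norm.
Qed.

Lemma ev_bounded p : exists2 C, 0 <= C &
  forall s y, 0 <= s <= T -> 1 <= y -> nc (ev p s (iy y)^-1) <= C.
Proof.
elim/poly_ind: p => [|p c [C C0 hC]].
  by exists 0 => // s y _ _; rewrite /ev rmorph0 horner0 nc0.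
have [D D0 hD] := poly_bounded c.
exists (C + D); first by rewrite addr_ge0.
move=> s y sT y1; rewrite evD evM evX evC (le_trans (ncD _ _))// lerD//.
  rewrite ncM nc_iyV; last by rewrite (le_trans _ y1).
  rewrite -[leRHS]mulr1 ler_pM ?nc_ge0 ?invr_ge0 ?hC// ?(le_trans _ y1)//.
  by rewrite invf_le1// (lt_le_trans _ y1).
by rewrite nc_real hD.
Qed.

Lemma invy_le1 (y : R) k : 1 <= y -> 0 <= y^-1 ^+ k <= 1.
Proof.
move=> y1; have y0 : 0 < y by rewrite (lt_le_trans _ y1).
rewrite exprn_ge0 ?invr_ge0 ?(ltW y0)//= exprn_ile1 ?invr_ge0 ?(ltW y0)//.
by rewrite invf_le1.
Qed.

Lemma expandsP k F : expands k F -> exists p C, 0 <= C /\ forall s y,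
  0 <= s <= T -> 1 <= y -> nc (F s y - ev p s (iy y)^-1) <= C * y^-1 ^+ k.
Proof.
move=> [p [C h]]; exists p, `|C|; split => // s y sT y1.
have /andP[? _] := @invy_le1 y k y1.
by rewrite (le_trans (h s y sT y1))// ler_wpM2r// ler_norm.
Qed.

Lemma expands_ext k F G : (forall s y, 0 <= s <= T -> 1 <= y -> F s y = G s y) ->
  expands k F -> expands k G.
Proof.
move=> FG [p [C h]]; exists p, C => s y sT y1.
by rewrite -FG//; exact: h.
Qed.

Lemma expands_bounded k F : expands k F -> exists2 C, 0 <= C & forall s y,
  0 <= s <= T -> 1 <= y -> nc (F s y) <= C.
Proof.
move=> /expandsP[p [C [C0 h]]]; have [D D0 hD] := ev_bounded p.
exists (C + D); first by rewrite addr_ge0.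
move=> s y sT y1; rewrite -[F s y](subrK (ev p s (iy y)^-1)).
rewrite (le_trans (ncD _ _))// lerD ?hD// (le_trans (h s y sT y1))//.
by rewrite -[leRHS]mulr1 ler_wpM2l//; have /andP[] := @invy_le1 y k y1.
Qed.

Lemma bounded_expands C F : (forall s y, 0 <= s <= T -> 1 <= y ->
  nc (F s y) <= C) -> expands 0 F.
Proof.
move=> h; exists 0, C => s y sT y1.
by rewrite /ev rmorph0 horner0 subr0 expr0 mulr1 h.
Qed.

Lemma expands_ev k p : expands k (fun s y => ev p s (iy y)^-1).
Proof. by exists p, 0 => s y _ _; rewrite subrr nc0 mul0r. Qed.

Lemma expandsW k l F : (l <= k)%N -> expands k F -> expands l F.
Proof.
move=> lk /expandsP[p [C [C0 h]]]; exists p, C => s y sT y1.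
rewrite (le_trans (h s y sT y1))// ler_wpM2l//.
have /andP[a b] := @invy_le1 y 1 y1; rewrite expr1 in a b.
by rewrite ler_wiXn2l.
Qed.

Lemma expandsD k F G : expands k F -> expands k G ->
  expands k (fun s y => F s y + G s y).
Proof.
move=> [p [C h]] [q [D g]]; exists (p + q), (C + D) => s y sT y1.
rewrite evD opprD addrACA mulrDl (le_trans (ncD _ _))// lerD//.
  exact: h.
exact: g.
Qed.

Lemma expandsN k F : expands k F -> expands k (fun s y => - F s y).
Proof.
move=> [p [C h]]; exists (- p), C => s y sT y1.
by rewrite evN -opprD ncN h.
Qed.

Lemma expandsM k F G : expands k F -> expands k G ->
  expands k (fun s y => F s y * G s y).
Proof.
move=> hF hG; have [B B0 hB] := expands_bounded hG.
move: hF hG => /expandsP[p [C [C0 h]]] /expandsP[q [D [D0 g]]].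
have [E E0 hE] := ev_bounded p.
exists (p * q), (C * B + E * D) => s y sT y1; rewrite evM.
have -> : F s y * G s y - ev p s (iy y)^-1 * ev q s (iy y)^-1 =
  (F s y - ev p s (iy y)^-1) * G s y +
  ev p s (iy y)^-1 * (G s y - ev q s (iy y)^-1) by ring.
rewrite (le_trans (ncD _ _))// [leRHS]mulrDl lerD//.
  by rewrite ncM mulrAC ler_pM ?nc_ge0 ?h ?hB.
by rewrite ncM -mulrA ler_pM ?nc_ge0 ?g ?hE.
Qed.

Lemma expandsMu k F : expands k F ->
  expands k.+1 (fun s y => (iy y)^-1 * F s y).
Proof.
move=> [p [C h]]; exists ('X * p), C => s y sT y1.
have y0 : 0 <= y by rewrite (le_trans _ y1).
rewrite evM evX -mulrBr ncM nc_iyV// exprS mulrCA ler_wpM2l ?invr_ge0//.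
exact: h.
Qed.

(** With a = F/(iy), the identity 1/(1 + a) = 1 - (iy)^-1 F/(1 + a) gains one order at each use,
    starting from the assumed bound, which is order 0. The prefactor (iy)^-1 explains the final
    order k + 1. *)
Lemma expands_inv k F C : expands k F ->
  (forall s y, 0 <= s <= T -> 1 <= y -> 1 + (iy y)^-1 * F s y != 0) ->
  (forall s y, 0 <= s <= T -> 1 <= y -> nc (1 + (iy y)^-1 * F s y)^-1 <= C) ->
  expands k.+1 (fun s y => (1 + (iy y)^-1 * F s y)^-1).
Proof.
move=> hF F0 FC.
suff H j : (j <= k.+1)%N -> expands j (fun s y => (1 + (iy y)^-1 * F s y)^-1).
  exact: H.
elim: j => [_|j ih jk]; first exact: bounded_expands FC.
have h1 := expandsM (expandsW (ltnSE jk) hF) (ih (ltnW jk)).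
have h2 := expandsD (expands_ev j.+1 1) (expandsN (expandsMu h1)).
apply: expands_ext h2 => s y sT y1 /=; rewrite ev1.
have := F0 s y sT y1; set a := (iy y)^-1 * F s y => a0.
by apply: (mulIf a0); rewrite mulrA -/a mulrBl mul1r -mulrA !mulVf// mulr1 addrK.
Qed.

End Expansion.

(** * Expansions along the flow of a vector field *)

Section Flow.
Variables (R : realType).
Local Notation nc := (@Normc.normc R).

(** Same shape as the conjunction in [associated_pair], which therefore yields it directly. *)
Definition cderiv (f : R -> R[i]) (s : R) (d : R[i]) : Prop :=
  is_derive s 1 (fun t => complex.Re (f t)) (complex.Re d) /\
  is_derive s 1 (fun t => complex.Im (f t)) (complex.Im d).

Definition ccontinuous (A : set R) (f : R -> R[i]) : Prop :=
  {within A, continuous (fun t => complex.Re (f t))} /\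
  {within A, continuous (fun t => complex.Im (f t))}.

Lemma cderivD f g s df dg : cderiv f s df -> cderiv g s dg ->
  cderiv (fun t => f t + g t) s (df + dg).
Proof.
move=> [f1 f2] [g1 g2]; split.
  rewrite cReD; under eq_fun do rewrite cReD.
  exact: (is_deriveD (f := fun t => complex.Re (f t))
    (g := fun t => complex.Re (g t))).
rewrite cImD; under eq_fun do rewrite cImD.
exact: (is_deriveD (f := fun t => complex.Im (f t))
  (g := fun t => complex.Im (g t))).
Qed.

Lemma cderiv_cst (a : R[i]) s : cderiv (fun=> a) s 0.
Proof. by split; exact: is_derive_cst. Qed.

Lemma cderivMl (a : R[i]) f s df : cderiv f s df ->
  cderiv (fun t => a * f t) s (a * df).
Proof.
move=> [f1 f2]; split.
  rewrite cReM; under eq_fun do rewrite cReM.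
  exact: (is_deriveB (f := complex.Re a \*: (fun t => complex.Re (f t)))
     (g := complex.Im a \*: (fun t => complex.Im (f t)))).
rewrite cImM; under eq_fun do rewrite cImM.
exact: (is_deriveD (f := complex.Re a \*: (fun t => complex.Im (f t)))
     (g := complex.Im a \*: (fun t => complex.Re (f t)))).
Qed.

Lemma cderivB f g s df dg : cderiv f s df -> cderiv g s dg ->
  cderiv (fun t => f t - g t) s (df - dg).
Proof.
move=> fd /(cderivMl (-1)); rewrite mulN1r => gd.
have := cderivD fd gd; congr cderiv.
by apply/funext => t; rewrite mulN1r.
Qed.

Lemma cderiv_real (p : {poly R}) s :
  cderiv (fun t => real_complex R p.[t]) s (real_complex R p^`().[s]).
Proof. by split => /=; [exact: is_derive_poly|exact: is_derive_cst]. Qed.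

Lemma cderiv_ccontinuous (A : set R) f df :
  (forall s, cderiv f s (df s)) -> ccontinuous A f.
Proof.
move=> fd; split; apply: continuous_subspaceT => s;
  apply/differentiable_continuous/derivable1_diffP; have [d1 d2] := fd s.
  exact: ex_derive.
exact: ex_derive.
Qed.

Lemma poly_primitive (p : {poly R}) :
  exists2 q : {poly R}, q^`() = p & q.[0] = 0.
Proof.
exists (\sum_(i < size p) (p`_i / i.+1%:R) *: 'X^(i.+1)).
  rewrite linear_sum -[RHS]coefK poly_def /=.
  apply: eq_bigr => i _; rewrite derivZ derivXn/= -scalerMnr scalerMnl -mulr_natr.
  by rewrite mulfVK// pnatr_eq0.
rewrite horner_sum big1// => i _.
by rewrite hornerZ hornerXn expr0n mulr0.
Qed.

(** Integration in time acts on each coefficient, so the primitive keeps real polynomial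
    coefficients and a single [q] serves all u. *)
Lemma ev_primitive (p : {poly {poly R}}) : exists q : {poly {poly R}},
  forall u, ev q 0 u = 0 /\ forall s, cderiv (fun t => ev q t u) s (ev p s u).
Proof.
elim/poly_ind: p => [|p c [q hq]].
  exists 0 => u; rewrite /ev; split=> [|s]; first by rewrite rmorph0 horner0.
  under eq_fun do rewrite rmorph0 horner0.
  by rewrite rmorph0 horner0; exact: cderiv_cst.
have [d dc d0] := poly_primitive c.
exists (q * 'X + d%:P) => u; have [q0 qd] := hq u; split=> [|s].
  by rewrite evD evM evX evC q0 mul0r add0r d0.
rewrite evD evM evX evC -dc.
under eq_fun do rewrite evD evM evX evC.
apply: cderivD (cderiv_real _ _).
rewrite mulrC; under eq_fun do rewrite mulrC.
exact: cderivMl.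
Qed.

(** The one-sided form matters for the passage from mu to tau, where positivity controls the
    derivative on one side only. *)
Lemma le_of_derive (f df : R -> R) (C T : R) : 0 <= T ->
  (forall s, 0 < s < T -> is_derive s 1 f (df s)) ->
  {within `[0, T], continuous f} ->
  (forall s, 0 < s < T -> df s <= C) -> f T - f 0 <= C * T.
Proof.
rewrite le_eqVlt => /predU1P[<- _ _ _|T0 fd fc fC].
  by rewrite subrr mulr0.
have fd' x : x \in `]0, T[ -> is_derive x 1 f (df x).
  by rewrite in_itv/=; exact: fd.
have [c cT ->] := MVT T0 fd' fc.
by rewrite subr0 ler_wpM2r ?(ltW T0)// fC//; rewrite in_itv in cT.
Qed.

Lemma norm_le_of_derive (f df : R -> R) (C T : R) : 0 <= T ->
  (forall s, 0 < s < T -> is_derive s 1 f (df s)) ->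
  {within `[0, T], continuous f} ->
  (forall s, 0 < s < T -> `|df s| <= C) -> `|f T - f 0| <= C * T.
Proof.
move=> T0 fd fc fC; rewrite ler_norml; apply/andP; split; last first.
  apply: (le_of_derive T0 fd fc) => s sT.
  by rewrite (le_trans (ler_norm _))// fC.
have h : {within `[0, T], continuous (fun t => - f t)}.
  by move=> x; apply: cvgN; exact: fc.
have := @le_of_derive (fun t => - f t) (fun t => - df t) C T T0 _ h.
rewrite -opprD lerNl; apply => s sT.
  exact: (is_deriveN (f := f) (fd _ sT)).
by rewrite (le_trans (ler_norm _))// normrN fC.
Qed.

(** The mean value theorem is applied to the real and imaginary parts separately, whence the factor
    2. *)
Lemma nc_le_of_derive (f df : R -> R[i]) (C T : R) : 0 <= T ->
  (forall s, 0 < s < T -> cderiv f s (df s)) ->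
  ccontinuous `[0, T] f ->
  (forall s, 0 < s < T -> nc (df s) <= C) -> nc (f T - f 0) <= 2 * C * T.
Proof.
move=> T0 fd [fc1 fc2] fC.
rewrite (le_trans (nc_le_ReIm _))// -mulrA mulr2n mulrDl mul1r !(cReD,cImD,cReN,cImN).
apply: lerD.
  apply: (norm_le_of_derive T0 (fun s sT => (fd s sT).1)) => // s sT.
  by rewrite (le_trans (nc_ge_Re _))// fC.
apply: (norm_le_of_derive T0 (fun s sT => (fd s sT).2)) => // s sT.
by rewrite (le_trans (nc_ge_Im _))// fC.
Qed.

Definition evr (p : {poly R}) (u : R[i]) : R[i] := (map_poly (real_complex R) p).[u].

Lemma evr_expands T k (p : {poly R}) F : expands T k F ->
  expands T k (fun s y => evr p (F s y)).
Proof.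
move=> hF; elim/poly_ind: p => [|p c ih].
  apply: expands_ext (expands_ev T k 0) => s y _ _.
  by rewrite /evr /ev !rmorph0 !horner0.
apply: expands_ext (expandsD (expandsM ih hF) (expands_ev T k (c%:P)%:P)) => s y _ _.
by rewrite evC hornerC /evr rmorphD rmorphM/= map_polyX map_polyC hornerMXaddC.
Qed.

(** * Flow of a vector field equal to a real polynomial in 1/w up to an error of order N in 1/Im
    w *)

Variables (T : R) (H : R -> R -> R[i]) (A E : R[i] -> R[i]) (P : {poly R}).
Variables (C : R) (N : nat).
Hypothesis H0 : forall y, 1 <= y -> H 0 y = iy y.
Hypothesis Hc : forall y, 1 <= y -> ccontinuous `[0, T] (H ^~ y).
Hypothesis Hd : forall s y, 0 < s -> 1 <= y -> cderiv (H ^~ y) s (A (H s y)).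
Hypothesis ImH : forall s y, 0 <= s -> 1 <= y -> y <= complex.Im (H s y).
Hypothesis AE : forall w, 1 <= complex.Im w -> A w = evr P w^-1 + E w.
Hypothesis EC : forall w, 1 <= complex.Im w ->
  nc (E w) <= C * (complex.Im w)^-1 ^+ N.

Lemma flow_nc s y : 0 <= s -> 1 <= y -> y <= nc (H s y).
Proof.
move=> s0 y1; rewrite (le_trans (ImH s0 y1))//.
by rewrite (le_trans (ler_norm _))// nc_ge_Im.
Qed.

Lemma flow_neq0 s y : 0 <= s -> 1 <= y -> H s y != 0.
Proof.
move=> s0 y1; rewrite -nc_gt0 (lt_le_trans _ (flow_nc s0 y1))//.
by rewrite (lt_le_trans _ y1).
Qed.

Lemma flow_ncV s y : 0 <= s -> 1 <= y -> nc (H s y)^-1 <= y^-1.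
Proof.
move=> s0 y1; have y0 : 0 < y by rewrite (lt_le_trans _ y1).
by rewrite ncV lef_pV2 ?posrE ?nc_gt0 ?flow_neq0 ?flow_nc.
Qed.

Lemma flow_error s y : 0 <= s -> 1 <= y -> nc (E (H s y)) <= `|C| * y^-1 ^+ N.
Proof.
move=> s0 y1; have y0 : 0 < y by rewrite (lt_le_trans _ y1).
have h := ImH s0 y1.
have h1 : 0 < complex.Im (H s y) by rewrite (lt_le_trans y0).
rewrite (le_trans (EC (le_trans y1 h)))//.
rewrite ler_pM// ?exprn_ge0 ?invr_ge0 ?(ltW h1)//.
(* No sign is assumed for [C]; it is nonnegative because its product with a positive number bounds a
   modulus. *)
- rewrite -(pmulr_lge0 (x := (complex.Im (H s y))^-1 ^+ N)) ?exprn_gt0 ?invr_gt0//.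
  by rewrite (le_trans (nc_ge0 _) (EC _))// (le_trans y1 h).
- exact: ler_norm.
- by rewrite lerXn2r ?nnegrE ?invr_ge0 ?(ltW y0) ?(ltW h1)// lef_pV2.
Qed.

(* [E] is kept exact: only the regular part [evr P] of the vector field is replaced
   by its expansion along the flow. *)
Lemma flow_primitive k : expands T k (fun s y => evr P (H s y)^-1) ->
  exists q C', [/\ 0 <= C', (forall u, ev q 0 u = 0),
    (forall y, 1 <= y -> ccontinuous `[0, T] (fun t => H t y - iy y - ev q t (iy y)^-1)) &
    forall s y, 0 < s <= T -> 1 <= y -> exists2 e, nc e <= C' * y^-1 ^+ k &
      cderiv (fun t => H t y - iy y - ev q t (iy y)^-1) s (E (H s y) + e)].
Proof.
move=> /expandsP[p [C' [C'0 h]]]; have [q hq] := ev_primitive p.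
exists q, C'; split=> // [u|y y1|s y /andP[s0 sT] y1].
- by have [] := hq u.
- have [hc1 hc2] := Hc y1.
  have [qc1 qc2] := @cderiv_ccontinuous `[0, T] _ _ (hq (iy y)^-1).2.
  split.
    rewrite (_ : (fun t => _) = (fun t => complex.Re (H t y) + - complex.Re (iy y)
      - complex.Re (ev q t (iy y)^-1))); last by apply/funext => t; rewrite !cReD !cReN.
    move=> x; apply: cvgB; last exact: qc1.
    by apply: cvgD; [exact: hc1|exact: cvg_cst].
  rewrite (_ : (fun t => _) = (fun t => complex.Im (H t y) + - complex.Im (iy y)
      - complex.Im (ev q t (iy y)^-1))); last by apply/funext => t; rewrite !cImD !cImN.
  move=> x; apply: cvgB; last exact: qc2.
  by apply: cvgD; [exact: hc2|exact: cvg_cst].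
exists (evr P (H s y)^-1 - ev p s (iy y)^-1).
  by apply: h => //; rewrite (ltW s0).
rewrite addrA [E _ + _]addrC -AE; last first.
  by rewrite (le_trans y1)// ImH// ltW.
have := cderivB (cderivB (Hd s0 y1) (cderiv_cst (iy y) s)) ((hq (iy y)^-1).2 s).
by rewrite subr0.
Qed.

(** Integration in time keeps the order, and k <= N lets [E] be absorbed into the error. *)
Lemma flow_bound k : (k <= N)%N -> expands T k (fun s y => evr P (H s y)^-1) ->
  expands T k (fun s y => H s y - iy y).
Proof.
move=> kN /flow_primitive[q [C' [C'0 q0 qc h]]].
exists q, (2 * (`|C| + C') * `|T|) => s y /andP[s0 sT] y1.
have y0 : 0 < y by rewrite (lt_le_trans _ y1).
pose D t := H t y - iy y - ev q t (iy y)^-1.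
have -> : H s y - iy y - ev q s (iy y)^-1 = D s - D 0.
  by rewrite /D H0// q0 !subrr subr0.
(* The derivative is known to exist with its bound at each time separately; [xget] gathers these
   values into the function that the mean value estimate expects. The default 0 is never reached on
   the open interval. *)
pose df t := xget 0 [set d | cderiv D t d /\
  nc d <= (`|C| + C') * y^-1 ^+ k].
have hdf t : 0 < t < s -> cderiv D t (df t) /\ nc (df t) <= (`|C| + C') * y^-1 ^+ k.
  move=> /andP[t0 ts]; have tT : 0 < t <= T by rewrite t0 (le_trans (ltW ts)).
  have [e ee ed] := h t y tT y1.
  apply: (@xgetPex _ 0 [set d | cderiv D t d /\
     nc d <= (`|C| + C') * y^-1 ^+ k]).
  exists (E (H t y) + e); split => //.
  rewrite (le_trans (ncD _ _))// mulrDl lerD//.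
  rewrite (le_trans (flow_error (ltW t0) y1))// ler_wpM2l//.
  by rewrite ler_wiXn2l ?invr_ge0 ?(ltW y0) ?invf_le1.
have Dc : ccontinuous `[0, s] D.
  have [c1 c2] := qc y y1.
  have sub : `[0, s] `<=` `[0, T].
    by move=> x /=; rewrite !in_itv/= => /andP[-> /le_trans->].
  by split; [exact: continuous_subspaceW c1|exact: continuous_subspaceW c2].
have := nc_le_of_derive s0 (fun t ht => (hdf t ht).1) Dc (fun t ht => (hdf t ht).2).
move=> /le_trans; apply.
rewrite mulrA [leRHS]mulrAC ler_wpM2l//; last by rewrite (le_trans sT)// ler_norm.
by rewrite !mulr_ge0 ?addr_ge0 ?exprn_ge0 ?invr_ge0 ?(ltW y0).
Qed.

(** Two orders are gained: one when inverting 1 + (H - iy)/(iy) = H/(iy), whose inverse is bounded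
    by 1 because |H| >= y, and one from the factor (iy)^-1 in 1/H = (iy)^-1 (H/(iy))^-1. *)
Lemma flow_inv_expands k : expands T k (fun s y => H s y - iy y) ->
  expands T k.+2 (fun s y => evr P (H s y)^-1).
Proof.
move=> h; apply: evr_expands.
have Hfact s y : 0 <= s -> 1 <= y ->
    1 + (iy y)^-1 * (H s y - iy y) = (iy y)^-1 * H s y.
  move=> s0 y1; have z0 : iy y != 0 by rewrite iy_neq0// (lt_le_trans _ y1).
  by rewrite mulrBr (mulVf z0) [LHS]addrC subrK.
have := @expands_inv _ T k (fun s y => H s y - iy y) 1 h.
case=> [s y /andP[s0 _] y1|s y /andP[s0 _] y1|p [C' hC]].
- rewrite Hfact// mulf_neq0 ?flow_neq0// invr_eq0 iy_neq0//.
  by rewrite (lt_le_trans _ y1).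
- have y0 : 0 < y by rewrite (lt_le_trans _ y1).
  rewrite Hfact// invfM invrK ncM nc_iy ?(ltW y0)// -ler_pdivlMl// mulr1.
  exact: flow_ncV.
apply: expands_ext (expandsMu (ex_intro _ p (ex_intro _ C' hC))) => s y /andP[s0 _] y1.
by rewrite Hfact// invfM invrK mulrA mulVf ?mul1r// iy_neq0// (lt_le_trans _ y1).
Qed.

Lemma flow_expands : expands T N (fun s y => H s y - iy y).
Proof.
suff h k : (k <= N)%N -> expands T k (fun s y => H s y - iy y) by exact: h.
elim: k => [_|k ih kN].
  apply: flow_bound => //; apply: evr_expands.
  apply: (bounded_expands (C := 1)) => s y /andP[s0 _] y1.
  by rewrite (le_trans (flow_ncV s0 y1))// invf_le1// (lt_le_trans _ y1).
apply: flow_bound => //.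
by apply: expandsW (flow_inv_expands (ih (ltnW kN))).
Qed.

End Flow.

(** * Cauchy transforms *)

Section CauchyTransform.
Variables (R : realType) (m : {measure set R -> \bar R}).
Local Notation nc := (@Normc.normc R).
Local Notation intg g := (m.-integrable setT (EFin \o (g : R -> R))).
Local Notation rint g := (Rintegral m setT g).

Lemma intg_measurable (g : R -> R) : intg g -> measurable_fun setT g.
Proof. by move=> /integrableP[/measurable_EFinP]. Qed.

Lemma intg_le (f g : R -> R) : measurable_fun setT f ->
  (forall x, `|f x| <= g x) -> intg g -> intg f.
Proof.
move=> mf fg; apply: le_integrable => //; first exact/measurable_EFinP.
by move=> x _ /=; rewrite lee_fin (le_trans (fg x))// ler_norm.
Qed.

Lemma intgD (f g : R -> R) : intg f -> intg g -> intg (fun x => f x + g x).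
Proof. exact: integrableD. Qed.

Lemma intgZ (c : R) (f : R -> R) : intg f -> intg (fun x => c * f x).
Proof. exact: integrableZl. Qed.

Lemma intg_norm (f : R -> R) : intg f -> intg (fun x => `|f x|).
Proof.
move=> fi; have mf := intg_measurable fi; apply: le_integrable fi => //.
  by apply/measurable_EFinP; exact: measurableT_comp.
by move=> x _ /=; rewrite lee_fin normr_id.
Qed.

Definition cmeasurable (f : R -> R[i]) : Prop :=
  measurable_fun setT (fun x => complex.Re (f x)) /\
  measurable_fun setT (fun x => complex.Im (f x)).

Definition cintegrable (f : R -> R[i]) : Prop :=
  intg (fun x => complex.Re (f x)) /\ intg (fun x => complex.Im (f x)).

Lemma cmeasurableM (f g : R -> R[i]) : cmeasurable f -> cmeasurable g ->
  cmeasurable (fun x => f x * g x).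
Proof.
move=> [f1 f2] [g1 g2]; split.
  rewrite (_ : (fun x => _) = (fun x => complex.Re (f x) * complex.Re (g x)
    - complex.Im (f x) * complex.Im (g x))); last by apply/funext => x; rewrite cReM.
  by apply: measurable_funB; exact: measurable_funM.
rewrite (_ : (fun x => _) = (fun x => complex.Re (f x) * complex.Im (g x)
  + complex.Im (f x) * complex.Re (g x))); last by apply/funext => x; rewrite cImM.
by apply: measurable_funD; exact: measurable_funM.
Qed.

Lemma cmeasurable_real (g : R -> R) : measurable_fun setT g ->
  cmeasurable (fun x => real_complex R (g x)).
Proof. by move=> mg; split => //=; exact: measurable_cst. Qed.

Lemma cintegrable_le (f : R -> R[i]) (g : R -> R) : cmeasurable f ->
  (forall x, nc (f x) <= g x) -> intg g -> cintegrable f.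
Proof.
move=> [f1 f2] fg ig; split; apply: intg_le ig => // x.
  exact: le_trans (nc_ge_Re _) (fg x).
exact: le_trans (nc_ge_Im _) (fg x).
Qed.

Lemma cintegrableD f g : cintegrable f -> cintegrable g ->
  cintegrable (fun x => f x + g x).
Proof.
move=> [f1 f2] [g1 g2]; split.
  rewrite (_ : _ \o _ = EFin \o (fun x => complex.Re (f x) + complex.Re (g x))).
    exact: intgD.
  by apply/funext => x /=; rewrite cReD.
rewrite (_ : _ \o _ = EFin \o (fun x => complex.Im (f x) + complex.Im (g x))).
  exact: intgD.
by apply/funext => x /=; rewrite cImD.
Qed.

Lemma cintegrableM c f : cintegrable f -> cintegrable (fun x => c * f x).
Proof.
move=> [f1 f2]; split.
  rewrite (_ : _ \o _ = EFin \o (fun x => complex.Re c * complex.Re (f x)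
     + (- complex.Im c) * complex.Im (f x))); first by apply: intgD; exact: intgZ.
  by apply/funext => x /=; rewrite cReM mulNr.
rewrite (_ : _ \o _ = EFin \o (fun x => complex.Re c * complex.Im (f x)
     + complex.Im c * complex.Re (f x))); first by apply: intgD; exact: intgZ.
by apply/funext => x /=; rewrite cImM.
Qed.

Lemma cintegralD f g : cintegrable f -> cintegrable g ->
  cintegral m (fun x => f x + g x) = cintegral m f + cintegral m g.
Proof.
move=> [f1 f2] [g1 g2]; rewrite /cintegral.
under eq_Rintegral do rewrite cReD.
under [X in Complex _ X]eq_Rintegral do rewrite cImD.
by rewrite !RintegralD.
Qed.

Lemma cintegralM c f : cintegrable f ->
  cintegral m (fun x => c * f x) = c * cintegral m f.
Proof.
move=> [f1 f2]; rewrite /cintegral.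
under eq_Rintegral do rewrite cReM.
under [X in Complex _ X]eq_Rintegral do rewrite cImM.
rewrite RintegralB ?RintegralD// ?RintegralZl//; try exact: intgZ.
by case: c.
Qed.

Lemma cintegral_real g : cintegral m (fun x => real_complex R (g x)) =
  real_complex R (rint g).
Proof. by rewrite /cintegral /= Rintegral_cst// mul0r. Qed.

Lemma nc_cintegral_le (f : R -> R[i]) (g : R -> R) : cintegrable f -> intg g ->
  (forall x, nc (f x) <= g x) -> nc (cintegral m f) <= 2 * rint g.
Proof.
move=> [f1 f2] ig fg; rewrite (le_trans (nc_le_ReIm _))//= mulr2n mulrDl mul1r.
apply: lerD; rewrite (le_trans (le_normr_Rintegral _ _))//;
  apply: le_Rintegral => // [|x _]; try exact: intg_norm.
  exact: le_trans (nc_ge_Re _) (fg x).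
exact: le_trans (nc_ge_Im _) (fg x).
Qed.

Lemma subr_real_neq0 (w : R[i]) (x : R) : 0 < complex.Im w ->
  w - real_complex R x != 0.
Proof.
move=> w0; apply: contraTneq w0 => /(congr1 (@complex.Im R)).
by rewrite cImD cImN /= subr0 => ->; rewrite ltxx.
Qed.

Lemma Im_le_ncB (w : R[i]) (x : R) : complex.Im w <= nc (w - real_complex R x).
Proof.
have := nc_ge_Im (w - real_complex R x); rewrite cImD cImN /= subr0.
exact/le_trans/ler_norm.
Qed.

Lemma continuous_resolvent (w : R[i]) : 0 < complex.Im w ->
  continuous (fun x => complex.Re (w - real_complex R x)^-1) /\
  continuous (fun x => complex.Im (w - real_complex R x)^-1).
Proof.
case: w => a b; rewrite [complex.Im _]/= => b0.
have cden : continuous (fun x : R => ((a - x) ^+ 2 + b ^+ 2)^-1).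
  move=> x; apply: cvgV; first by rewrite gt_eqF// ltr_wpDl ?sqr_ge0// exprn_gt0.
  have -> : (a - x) ^+ 2 + b ^+ 2 = (a - x) * (a - x) + b ^+ 2 by rewrite expr2.
  under eq_fun do rewrite [_ ^+ 2]expr2.
  apply: cvgD; last exact: cvg_cst.
  by apply: cvgM; apply: cvgB; [exact: cvg_cst|exact: cvg_id|exact: cvg_cst|exact: cvg_id].
split.
  rewrite (_ : (fun _ => _) = (fun x : R => (a - x) * ((a - x) ^+ 2 + b ^+ 2)^-1)).
    move=> x; apply: cvgM; last exact: cden.
    by apply: cvgB; [exact: cvg_cst|exact: cvg_id].
  by apply/funext => x; rewrite cReV /= oppr0 addr0.
rewrite (_ : (fun _ => _) = (fun x : R => - b * ((a - x) ^+ 2 + b ^+ 2)^-1)).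
  by move=> x; apply: cvgM; [exact: cvg_cst|exact: cden].
by apply/funext => x; rewrite cImV /= oppr0 addr0.
Qed.

Lemma cmeasurable_resolvent (w : R[i]) : 0 < complex.Im w ->
  cmeasurable (fun x => (w - real_complex R x)^-1).
Proof. by move=> /continuous_resolvent[? ?]; split; exact: continuous_measurable_fun. Qed.

(** Cauchy transform of the measure with density g with respect to m. The weight 1 gives the usual
    transform, powers of x give Taylor remainders, and 1 + x^2 occurs in the generator. *)
Definition cauchyT (g : R -> R) (w : R[i]) : R[i] :=
  cintegral m (fun x => real_complex R (g x) * (w - real_complex R x)^-1).

Lemma cmeasurable_cauchyT g w : measurable_fun setT g -> 0 < complex.Im w ->
  cmeasurable (fun x => real_complex R (g x) * (w - real_complex R x)^-1).
Proof.
move=> mg w0; apply: cmeasurableM; first exact: cmeasurable_real.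
exact: cmeasurable_resolvent.
Qed.

Lemma nc_resolvent_le (w : R[i]) (x : R) : 0 < complex.Im w ->
  nc (w - real_complex R x)^-1 <= (complex.Im w)^-1.
Proof.
move=> w0; rewrite ncV lef_pV2 ?posrE ?Im_le_ncB// nc_gt0.
exact: subr_real_neq0.
Qed.

Lemma nc_xresolvent_le (w : R[i]) (x : R) : 0 < complex.Im w ->
  nc (real_complex R x * (w - real_complex R x)^-1) <= 1 + nc w / complex.Im w.
Proof.
move=> w0; have h := subr_real_neq0 x w0.
have -> : real_complex R x * (w - real_complex R x)^-1 =
  w * (w - real_complex R x)^-1 - 1.
  by rewrite -[1 in RHS](mulfV h) -mulrBl subKr.
rewrite (le_trans (ncB _ _))// nc1 addrC lerD2l ncM ler_wpM2l ?nc_ge0//.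
exact: nc_resolvent_le.
Qed.

Lemma cintegrable_cauchyT g w : intg g -> 0 < complex.Im w ->
  cintegrable (fun x => real_complex R (g x) * (w - real_complex R x)^-1).
Proof.
move=> ig w0; apply: (@cintegrable_le _ (fun x => (complex.Im w)^-1 * `|g x|)).
- by apply: cmeasurable_cauchyT => //; exact: intg_measurable.
- move=> x; rewrite ncM nc_real mulrC ler_wpM2r//.
  exact: nc_resolvent_le.
- by apply: intgZ; exact: intg_norm.
Qed.

(** A further factor x costs no integrability, since x/(w - x) = w/(w - x) - 1 is bounded for fixed
    w. *)
Lemma cintegrable_xcauchyT g w : intg g -> 0 < complex.Im w ->
  cintegrable (fun x => real_complex R (x * g x) * (w - real_complex R x)^-1).
Proof.
move=> ig w0.
apply: (@cintegrable_le _ (fun x => (1 + nc w / complex.Im w) * `|g x|)).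
- by apply: cmeasurable_cauchyT => //; apply: measurable_funM => //; exact: intg_measurable.
- move=> x; rewrite rmorphM/= mulrAC ncM nc_real ler_wpM2r//.
  exact: nc_xresolvent_le.
- by apply: intgZ; exact: intg_norm.
Qed.

Lemma cintegrable_real g : intg g -> cintegrable (fun x => real_complex R (g x)).
Proof.
move=> ig; apply: cintegrable_le (intg_norm ig).
  by apply: cmeasurable_real; exact: intg_measurable.
by move=> x; rewrite nc_real.
Qed.

(* w / (w - x) = 1 + x / (w - x) *)
Lemma cauchyT_step g w : intg g -> 0 < complex.Im w ->
  cauchyT g w = w^-1 * (real_complex R (rint g) + cauchyT (fun x => x * g x) w).
Proof.
move=> ig w0; have wn0 : w != 0.
  by apply: contraTneq w0 => ->; rewrite ltxx.
rewrite -cintegral_real -cintegralD; first last.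
- exact: cintegrable_xcauchyT.
- exact: cintegrable_real.
have -> : (fun x => real_complex R (g x) +
    real_complex R (x * g x) * (w - real_complex R x)^-1) =
  (fun x => w * (real_complex R (g x) * (w - real_complex R x)^-1)).
  apply/funext => x; have h := subr_real_neq0 x w0.
  by rewrite rmorphM/=; field.
rewrite cintegralM; last exact: cintegrable_cauchyT.
by rewrite mulrA mulVf// mul1r.
Qed.

(** Iteration of [cauchyT_step]: the coefficient of w^-(k+1) is the real number int x^k g. Only
    moments below N enter, the remainder being kept as an exact transform. *)
Lemma cauchyT_taylor g N :
  (forall k, (k < N)%N -> intg (fun x => x ^+ k * g x)) ->
  exists P : {poly R}, forall w, 0 < complex.Im w ->
    cauchyT g w = evr P w^-1 + w^-1 ^+ N * cauchyT (fun x => x ^+ N * g x) w.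
Proof.
elim: N => [_|N ih h].
  exists 0 => w w0; rewrite /evr rmorph0 horner0 add0r expr0 mul1r.
  by rewrite (_ : (fun x => _) = g)//; apply/funext => x; rewrite expr0 mul1r.
have [P hP] := ih (fun k kN => h k (ltnW kN)).
exists (P + (rint (fun x => x ^+ N * g x)) *: 'X^(N.+1)) => w w0.
rewrite hP// cauchyT_step//; last exact: h.
rewrite mulrA -exprSr mulrDr addrA; congr (_ + _).
  rewrite /evr rmorphD/= hornerD; congr (_ + _).
  by rewrite map_polyZ map_polyXn hornerZ hornerXn mulrC.
rewrite (_ : (fun x => x * _) = (fun x => x ^+ N.+1 * g x))//.
by apply/funext => x; rewrite mulrA -exprS.
Qed.

(* w^-1 x / (w - x) = 1 / (w - x) - w^-1 *)
Lemma cauchyT_remainder g N : intg (fun x => x ^+ N * g x) ->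
  exists C, forall w, 0 < complex.Im w ->
    nc (w^-1 ^+ N.+1 * cauchyT (fun x => x ^+ N.+1 * g x) w)
      <= C * (complex.Im w)^-1 ^+ N.+1.
Proof.
move=> ig; set G := fun x => x ^+ N * g x in ig *.
(* The first term bounds the transform of [G], with the factor 2 of [nc_cintegral_le]; the second
   bounds the subtracted mean of [G]. *)
exists (2 * rint (fun x => `|G x|) + `|rint G|) => w w0.
have wV : nc w^-1 <= (complex.Im w)^-1.
  by have := nc_resolvent_le 0 w0; rewrite rmorph0 subr0.
have -> : (fun x => x ^+ N.+1 * g x) = (fun x => x * G x).
  by apply/funext => x; rewrite exprS mulrA.
have -> : w^-1 ^+ N.+1 * cauchyT (fun x => x * G x) w =
    w^-1 ^+ N * (cauchyT G w - w^-1 * real_complex R (rint G)).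
  by rewrite (cauchyT_step ig w0) -mulrBr [_ + cauchyT _ _]addrC addrK mulrA exprSr.
have I0 : 0 <= (complex.Im w)^-1 by rewrite invr_ge0 ltW.
rewrite ncM ncX exprSr mulrCA ler_pM ?exprn_ge0 ?nc_ge0//.
  by rewrite lerXn2r ?nnegrE ?nc_ge0.
rewrite (le_trans (ncB _ _))// mulrDl lerD//; last first.
  by rewrite ncM nc_real mulrC ler_wpM2l.
rewrite -mulrA [_ * _^-1]mulrC -RintegralZl//; last exact: intg_norm.
apply: nc_cintegral_le => //.
- exact: cintegrable_cauchyT.
- exact/intgZ/intg_norm.
- by move=> x; rewrite ncM nc_real mulrC ler_wpM2r// nc_resolvent_le.
Qed.

End CauchyTransform.

(** * Limits along y = k + 1: Fatou's lemma and dominated convergence *)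

Section Limits.
Variables (R : realType) (m : {measure set R -> \bar R}).
Local Notation nc := (@Normc.normc R).
Local Notation intg g := (m.-integrable setT (EFin \o (g : R -> R))).
Local Notation rint g := (Rintegral m setT g).

Lemma harmonic_small (C e : R) : 0 < e ->
  exists k0, forall k, (k0 <= k)%N -> C * k.+1%:R^-1 <= e.
Proof.
move=> e0; exists (Num.bound (`|C| / e)) => k k0.
rewrite ler_pdivrMr// mulrC -ler_pdivrMr// (@le_trans _ _ (`|C| / e))//.
  by rewrite ler_wpM2r ?ler_norm// invr_ge0 ltW.
rewrite (le_trans (ltW (archi_boundP _)))//; first by rewrite divr_ge0// ltW.
by rewrite ler_nat (leq_trans k0).
Qed.

Lemma cvg_scaled_harmonic (C : R) : C * k.+1%:R^-1 @[k --> \oo] --> (0 : R).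
Proof. by rewrite -(mulr0 C); apply: cvgM; [exact: cvg_cst|exact: cvg_harmonic]. Qed.

(** The cutoff y^2/(x^2 + y^2) tends to 1 pointwise, so Fatou's lemma turns a bound valid for all
    large y into integrability of [G] itself. *)
Lemma integrable_fatou (G : R -> R) (M : R) (k0 : nat) :
  (forall x, 0 <= G x) -> measurable_fun setT G ->
  (forall k, intg (fun x => G x * (k.+1%:R ^+ 2 / (x ^+ 2 + k.+1%:R ^+ 2)))) ->
  (forall k, (k0 <= k)%N ->
     rint (fun x => G x * (k.+1%:R ^+ 2 / (x ^+ 2 + k.+1%:R ^+ 2))) <= M) ->
  intg G.
Proof.
move=> G0 mG iG hM.
pose f k x := (G x * (k.+1%:R ^+ 2 / (x ^+ 2 + k.+1%:R ^+ 2)))%:E.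
have f0 k x : setT x -> (0 <= f k x)%E.
  by move=> _; rewrite lee_fin mulr_ge0// divr_ge0 ?addr_ge0 ?sqr_ge0.
have mf k : measurable_fun setT (f k).
  by apply/measurable_EFinP; exact: (intg_measurable (iG k)).
have fG x : f k x @[k --> \oo] --> (G x)%:E.
  apply: cvg_EFin; first exact: nearW.
  (* One minus the cutoff is x^2/(x^2 + y^2), which is at most x^2/y because y >= 1. *)
  apply: (@squeeze_cvgr _ _ _ _ (fun k => G x - G x * x ^+ 2 * k.+1%:R^-1)
    (fun=> G x)); last exact: cvg_cst.
    apply: nearW => k /=; have k1 : 1 <= k.+1%:R :> R by rewrite ler1n.
    have k2 : 0 < k.+1%:R :> R by rewrite ltr0n.
    set y : R := k.+1%:R in k1 k2 *.
    have d0 : 0 < x ^+ 2 + y ^+ 2 by rewrite ltr_wpDl ?sqr_ge0 ?exprn_gt0.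
    apply/andP; split; last first.
      rewrite -[leRHS]mulr1 ler_wpM2l// ler_pdivrMr// mul1r lerDr.
      exact: sqr_ge0.
    rewrite -[X in X - _]mulr1 -mulrA -mulrBr ler_wpM2l//.
    rewrite ler_pdivlMr// mulrBl mul1r.
    set Q := _ / y * _; suff : x ^+ 2 <= Q by lra.
    rewrite {}/Q -mulrA -[leLHS]mulr1 ler_wpM2l ?sqr_ge0//.
    rewrite ler_pdivlMl// mulr1.
    have : y <= y ^+ 2 by rewrite ler_eXnr.
    by have := sqr_ge0 x; lra.
  rewrite -[X in _ --> X]subr0; apply: cvgB; first exact: cvg_cst.
  exact: cvg_scaled_harmonic.
apply/integrableP; split; first exact/measurable_EFinP.
apply: (@le_lt_trans _ _ M%:E); last exact: ltry.
rewrite (_ : (fun x => _) = fun x => limn_einf (f^~ x)); last first.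
  apply/funext => x /=; have [-> _] := cvg_limn_einf_sup (fG x).
  by rewrite ger0_norm.
apply: le_trans (@fatou _ _ _ m setT measurableT f mf f0) _.
rewrite limn_einf_lim; apply: lime_le; first exact: is_cvg_einfs.
near=> k; apply: (@le_trans _ _ (\int[m]_x f k x)%E).
  by apply: ereal_inf_lbound; exists k => //=.
rewrite -[leLHS]fineK ?lee_fin; last by apply: integrable_fin_num => //; exact: iG.
by apply: hM; near: k; exact: nbhs_infty_ge.
Unshelve. all: by end_near. Qed.

Lemma measurable_truncation (y : R) : 0 < y ->
  measurable_fun setT (fun x : R => `|x| / (`|x| + y)).
Proof.
move=> y0; apply: continuous_measurable_fun => x.
have cn : `|z| @[z --> x] --> `|x| by exact: norm_continuous.
apply: cvgM => //; apply: cvgV; first by rewrite gt_eqF// ltr_wpDl.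
by apply: cvgD => //; exact: cvg_cst.
Qed.

(** Dominated convergence: the factor |x|/(|x| + y) is at most 1 and tends to 0 for each x. *)
Lemma truncated_integral_small (g : R -> R) (e : R) : intg g -> 0 < e ->
  exists k0, forall k, (k0 <= k)%N ->
    rint (fun x => `|g x| * (`|x| / (`|x| + k.+1%:R))) <= e.
Proof.
move=> ig e0.
pose f k x := (`|g x| * (`|x| / (`|x| + k.+1%:R)))%:E.
have d0 (k : nat) (x : R) : 0 < `|x| + k.+1%:R by rewrite ltr_wpDl// ltr0n.
have mf k : measurable_fun setT (f k).
  apply/measurable_EFinP; apply: measurable_funM.
    by apply: measurableT_comp => //; exact: (intg_measurable ig).
  by apply: measurable_truncation; rewrite ltr0n.
have fb k x : `|g x| * (`|x| / (`|x| + k.+1%:R)) <= `|g x|.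
  by rewrite -[leRHS]mulr1 ler_wpM2l// ler_pdivrMr// mul1r lerDl.
have f0 k x : 0 <= `|g x| * (`|x| / (`|x| + k.+1%:R)).
  by rewrite mulr_ge0// divr_ge0// ltW.
have [||||_ _] := @dominated_convergence _ _ _ m setT measurableT f (cst 0%E)
    (EFin \o (fun x => `|g x|)) mf.
- exact: measurable_cst.
- apply: aeW => x _; apply: cvg_EFin; first exact: nearW.
  apply: (@squeeze_cvgr _ _ _ _ (fun=> 0) (fun k => `|g x| * `|x| * k.+1%:R^-1)).
  + apply: nearW => k /=; rewrite f0/= -mulrA ler_wpM2l// ler_wpM2l//.
    by rewrite lef_pV2 ?posrE ?ltr0n// lerDr.
  + exact: cvg_cst.
  + exact: cvg_scaled_harmonic.
- exact: intg_norm.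
- by apply: aeW => x k _; rewrite /f /= lee_fin ger0_norm.
rewrite integral0 => /fine_cvg /cvgrPdist_le /(_ e e0) [k0 _ hk0].
exists k0 => k kk0; have := hk0 k kk0; rewrite /= sub0r normrN.
exact: le_trans (ler_norm _).
Qed.

(** Uniformity in w over Im w >= y, |w| <= B y covers both w = iy and the points H_s(iy) of the
    flow. *)
Lemma cauchyT_small (g : R -> R) (B e : R) : intg g -> 0 <= B -> 0 < e ->
  exists k0, forall k, (k0 <= k)%N -> forall w, k.+1%:R <= complex.Im w ->
    nc w <= B * k.+1%:R -> nc (cauchyT m (fun x => x * g x) w) <= e.
Proof.
move=> ig B0 e0.
(* The 2 comes from [nc_cintegral_le], and 2 + B from |x| + y <= (2 + B) |w - x|, which combines y
   <= |w - x| and |x| <= |w - x| + |w|. *)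
have c0 : 0 < 2 * (2 + B) by rewrite mulr_gt0// ltr_wpDr.
have [k0 hk0] := @truncated_integral_small g (e / (2 * (2 + B))) ig (divr_gt0 e0 c0).
exists k0 => k kk0 w wk wB; have := hk0 k kk0; rewrite ler_pdivlMr//.
set y : R := k.+1%:R in wk wB *; have y0 : 0 < y by rewrite ltr0n.
have w0 : 0 < complex.Im w by rewrite (lt_le_trans y0).
have d0 (x : R) : 0 < `|x| + y by rewrite ltr_wpDl.
have itr : intg (fun x => `|g x| * (`|x| / (`|x| + y))).
  apply: (@intg_le _ _ _ (fun x => `|g x|)); last exact: intg_norm.
    apply: measurable_funM.
      by apply: measurableT_comp => //; exact: (intg_measurable ig).
    exact: measurable_truncation.
  move=> x; rewrite ger0_norm; last by rewrite mulr_ge0// divr_ge0// ltW.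
  by rewrite -[leRHS]mulr1 ler_wpM2l// ler_pdivrMr// mul1r lerDl ltW.
move=> he; apply: le_trans he.
rewrite mulrC -mulrA -RintegralZl//.
apply: nc_cintegral_le => //; first exact: cintegrable_xcauchyT.
  exact: intgZ.
move=> x; rewrite ncM nc_real ncV normrM.
have h1 := Im_le_ncB w x.
have h2 : `|x| <= nc (w - real_complex R x) + nc w.
  by rewrite -nc_real addrC -{1}(subKr w (real_complex R x)) ncB.
have N0 : 0 < nc (w - real_complex R x) by rewrite nc_gt0 subr_real_neq0.
set N := nc _ in h1 h2 N0 *.
have BN : B * y <= B * N by rewrite ler_wpM2l// (le_trans wk).
have NV : N^-1 <= (2 + B) / (`|x| + y).
  by rewrite ler_pdivlMr// mulrC ler_pdivrMr//; lra.
apply: le_trans (ler_wpM2l _ NV) _; first by rewrite mulr_ge0.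
by rewrite le_eqVlt; apply/orP; left; apply/eqP; ring.
Qed.

End Limits.

(** * Positivity of the leading remainder *)

Section Positivity.
Variable R : realType.
Local Notation nc := (@Normc.normc R).

(** For w = a + ib and t = t1 + i t2, the right-hand side is the real part of -y^2 (1 + t) x/(w -
    x). Its main term x^2 dominates the terms linear in x by completing a square. *)
Lemma kernel_real_lower (y B D a b x t1 t2 : R) : 1 <= y -> 0 <= B -> B <= y ->
  4 * D <= y -> `|a| <= B -> y <= b -> b <= 2 * y ->
  `|t1| * y <= D -> `|t2| * y <= D ->
  40^-1 * (x ^+ 2 * (y ^+ 2 / (x ^+ 2 + y ^+ 2))) - (5 / 4 * B + 2 * D) ^+ 2 <=
  y ^+ 2 / ((a - x) ^+ 2 + b ^+ 2) *
    (x ^+ 2 - x * a + t1 * (x ^+ 2 - x * a) - t2 * (x * b)).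
Proof.
move=> y1 B0 By Dy aB yb b2y t1D t2D.
have y0 : 0 < y by lra.
(* Total coefficient of |x|: B from x a, B/4 from its perturbation since |t1| <= 1/4, and 2 D from
   t2 x b since b <= 2 y. Then L |x| <= (x^2 + L^2)/2. *)
set L := 5 / 4 * B + 2 * D.
set S := x ^+ 2 - _ + _ - _.
have hS : x ^+ 2 / 4 - L ^+ 2 / 2 <= S.
  have t14 : `|t1| <= 4^-1.
    by rewrite -(ler_pM2r y0) (le_trans t1D)//; lra.
  have e1 : `|x * a| <= `|x| * B by rewrite normrM ler_wpM2l.
  have e2 : `|t1 * (x ^+ 2 - x * a)| <= 4^-1 * (x ^+ 2 + `|x| * B).
    rewrite normrM ler_pM// (le_trans (ler_normB _ _))// lerD//.
    by rewrite ger0_norm ?sqr_ge0.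
  have e3 : `|t2 * (x * b)| <= 2 * D * `|x|.
    rewrite normrM normrM [`|b|]ger0_norm; last by lra.
    have : `|t2| * b <= 2 * D.
      by rewrite (@le_trans _ _ (`|t2| * (2 * y))) ?ler_wpM2l//; lra.
    move=> /(ler_wpM2r (normr_ge0 x)); congr (_ <= _); ring.
  have e4 : 0 <= (`|x| - L) ^+ 2 by rewrite sqr_ge0.
  have e5 : (`|x| - L) ^+ 2 = x ^+ 2 - 2 * (L * `|x|) + L ^+ 2.
    by rewrite sqrrB real_normK ?num_real// -mulr_natl; ring.
  have e6 : L * `|x| = 5 / 4 * (`|x| * B) + 2 * D * `|x| by rewrite /L; ring.
  move: e1 e2 e3; rewrite !ler_norml /S {S}.
  move: (x * a) (t1 * _) (t2 * _) (`|x| * B) (2 * D * `|x|) (L * `|x|) e5 e6.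
  move=> xa T1 T2 xB Dx Lx; move: ((`|x| - L) ^+ 2) e4 (x ^+ 2) (L ^+ 2).
  by move=> q ? x2 L2 ? ? /andP[? ?] /andP[? ?] /andP[? ?]; lra.
set den := (a - x) ^+ 2 + b ^+ 2.
have den0 : 0 < den by rewrite ltr_wpDl ?sqr_ge0// exprn_gt0// (lt_le_trans y0).
have b2 : y ^+ 2 <= b ^+ 2 by rewrite lerXn2r ?nnegrE//; lra.
have K1 : y ^+ 2 / den <= 1.
  by rewrite ler_pdivrMr// mul1r (le_trans b2)// lerDr sqr_ge0.
have K0 : 0 <= y ^+ 2 / den by rewrite divr_ge0 ?sqr_ge0// ltW.
have q0 : 0 < x ^+ 2 + y ^+ 2 by rewrite ltr_wpDl ?sqr_ge0// exprn_gt0.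
have den10 : den <= 10 * (x ^+ 2 + y ^+ 2).
  have h1 : b ^+ 2 <= (2 * y) ^+ 2 by rewrite lerXn2r ?nnegrE//; lra.
  have h2 : a ^+ 2 <= y ^+ 2.
    by rewrite -[a ^+ 2]real_normK ?num_real// lerXn2r ?nnegrE ?normr_ge0 ?(ltW y0)//; lra.
  have h3 : 0 <= (a + x) ^+ 2 by rewrite sqr_ge0.
  have h4 := sqr_ge0 x; rewrite /den; nra.
(* The constant 40 is 4 times 10, from x^2/4 in [hS] and from the bound [den10]. *)
have hK : 40^-1 * (x ^+ 2 * (y ^+ 2 / (x ^+ 2 + y ^+ 2))) <=
    y ^+ 2 / den * (x ^+ 2 / 4).
  have -> : 40^-1 * (x ^+ 2 * (y ^+ 2 / (x ^+ 2 + y ^+ 2))) =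
    y ^+ 2 * (10 * (x ^+ 2 + y ^+ 2))^-1 * (x ^+ 2 / 4).
    by field; rewrite gt_eqF.
  rewrite ler_wpM2r//; first by rewrite divr_ge0 ?sqr_ge0.
  by rewrite ler_wpM2l ?sqr_ge0// lef_pV2 ?posrE// mulr_gt0.
apply: le_trans (ler_wpM2l K0 hS); rewrite mulrBr lerB//.
have L2 : 0 <= L ^+ 2 by rewrite sqr_ge0.
apply: le_trans (ler_wpM2r _ K1) _; first by rewrite divr_ge0.
lra.
Qed.

(** With a = iy/w - 1 this bounds the relative error made when w^-n is replaced by (iy)^-n. *)
Lemma nc_1Dpow_sub1 (B : R) n : 0 <= B -> exists2 D, 0 <= D &
  forall a, nc a <= B -> nc ((1 + a) ^+ n - 1) <= D * nc a.
Proof.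
move=> B0; elim: n => [|n [D D0 h]].
  by exists 0 => // a _; rewrite expr0 subrr nc0 mul0r.
exists ((1 + B) * D + 1); first by rewrite addr_ge0// mulr_ge0// addr_ge0.
move=> a aB; have -> : (1 + a) ^+ n.+1 - 1 = (1 + a) * ((1 + a) ^+ n - 1) + a.
  by rewrite exprS; ring.
rewrite (le_trans (ncD _ _))// [leRHS]mulrDl mul1r lerD2r ncM -[leRHS]mulrA ler_pM ?nc_ge0 ?h//.
by rewrite (le_trans (ncD _ _))// nc1 lerD2l.
Qed.

(** The sign comes from (iy)^2 = -y^2: at w = iy the real part is exactly x^2 y^2/(x^2 + y^2).
    Elsewhere (iy/w)^n = 1 + O(1/y), and the perturbation costs a fraction of this kernel and a
    constant. *)
Lemma kernel_lower (B : R) n : 0 <= B -> exists C y0 : R, [/\ 0 <= C, 1 <= y0 &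
  forall y w x, y0 <= y -> y <= complex.Im w -> nc (w - iy y) <= B ->
  40^-1 * (x ^+ 2 * (y ^+ 2 / (x ^+ 2 + y ^+ 2))) - C <=
  complex.Re (iy y ^+ n.+2 * (w^-1 ^+ n *
    (real_complex R x * (w - real_complex R x)^-1)))].
Proof.
move=> B0; have [D D0 hD] := @nc_1Dpow_sub1 B n B0.
(* The threshold secures the hypotheses of [kernel_real_lower] with [D * B] for [D]: B <= y, 4 D B
   <= y and Im w <= y + B <= 2 y. *)
exists ((5 / 4 * B + 2 * (D * B)) ^+ 2), (1 + B + 4 * (D * B)).
have DB0 : 0 <= D * B by rewrite mulr_ge0.
split; [exact: sqr_ge0|lra|move=> y w x yy0 yw wB].
have y1 : 1 <= y by lra.
have y0 : 0 < y by lra.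
have w0 : 0 < complex.Im w by lra.
have wn0 : w != 0 by apply: contraTneq w0 => ->; rewrite ltxx.
have ncw : y <= nc w.
  by rewrite (le_trans yw)// (le_trans (ler_norm _))// nc_ge_Im.
pose d := (iy y - w) / w.
have ncd : nc d * y <= B.
  rewrite ncM ncV mulrAC ler_pdivrMr; last by rewrite (lt_le_trans y0).
  by rewrite ler_pM ?nc_ge0 ?(ltW y0)// -opprB ncN.
have ncdB : nc d <= B by rewrite (le_trans _ ncd)// ler_peMr// nc_ge0.
pose t := (1 + d) ^+ n - 1.
have ht : nc t * y <= D * B.
  rewrite (@le_trans _ _ (D * nc d * y))//.
    by rewrite ler_wpM2r ?(ltW y0)// hD.
  by rewrite -mulrA ler_wpM2l.
have -> : iy y ^+ n.+2 * (w^-1 ^+ n * (real_complex R x * (w - real_complex R x)^-1)) =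
  real_complex R (- y ^+ 2) * ((1 + t) * (real_complex R x * (w - real_complex R x)^-1)).
  rewrite !mulrA; congr (_ * _ * _).
  have -> : real_complex R (- y ^+ 2) = iy y ^+ 2.
    by rewrite !expr2 /= ; apply/eqP; rewrite eq_complex /=; apply/andP; split; apply/eqP; ring.
  have -> : 1 + t = (1 + d) ^+ n by rewrite /t [LHS]addrC subrK.
  rewrite -(addn2 n) exprD mulrAC mulrC; congr (_ * _).
  have -> : 1 + d = iy y * w^-1 by rewrite /d mulrBl (mulfV wn0) [LHS]addrC subrK.
  by rewrite exprMn.
clearbody t; have h1 := nc_ge_Re t; have h2 := nc_ge_Im t.
have aB : `|complex.Re w| <= B.
  by rewrite (le_trans _ wB)// (le_trans _ (nc_ge_Re _))// cReD cReN /= subr0.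
have bB : complex.Im w - y <= B.
  by rewrite (le_trans _ wB)// (le_trans _ (nc_ge_Im _))// cImD cImN /= ler_norm.
case: w t yw {wB} aB bB w0 ht h1 h2 {wn0 ncw d ncd ncdB} => a b [t1 t2] /= yw aB bB w0 ht h1 h2.
have := @kernel_real_lower y B (D * B) a b x t1 t2 y1 B0.
set l := 40^-1 * _ - _; move=> kr; apply: le_trans (kr _ _ _ _ _ _ _) _; try lra.
- by rewrite (le_trans _ ht)// ler_wpM2r// ltW.
- by rewrite (le_trans _ ht)// ler_wpM2r// ltW.
have den0 : (a - x) ^+ 2 + b ^+ 2 != 0.
  by rewrite gt_eqF// ltr_wpDl ?sqr_ge0// exprn_gt0.
rewrite !(mul0r, mulr0, subr0, addr0, oppr0, add0r, sub0r) le_eqVlt; apply/orP; left; apply/eqP.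
by field.
Qed.

Variable m : {measure set R -> \bar R}.
Local Notation intg g := (m.-integrable setT (EFin \o (g : R -> R))).
Local Notation rint g := (Rintegral m setT g).

Lemma measurable_cutoff (y : R) : 0 < y ->
  measurable_fun setT (fun x : R => y ^+ 2 / (x ^+ 2 + y ^+ 2)).
Proof.
move=> y0; apply: continuous_measurable_fun => x.
apply: cvgM; first exact: cvg_cst.
apply: cvgV; first by rewrite gt_eqF// ltr_wpDl ?sqr_ge0// exprn_gt0.
by apply: cvgD; [exact: exprn_continuous|exact: cvg_cst].
Qed.

Lemma intg_cutoff (g : R -> R) (y : R) : 0 < y -> intg g ->
  intg (fun x => (x ^+ 2 * g x) * (y ^+ 2 / (x ^+ 2 + y ^+ 2))).
Proof.
move=> y0 ig; apply: (@intg_le _ _ _ (fun x => y ^+ 2 * `|g x|)).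
- apply: measurable_funM; last exact: measurable_cutoff.
  by apply: measurable_funM; [exact: exprn_measurable|exact: (intg_measurable ig)].
- move=> x; have q0 : 0 < x ^+ 2 + y ^+ 2 by rewrite ltr_wpDl ?sqr_ge0// exprn_gt0.
  have c0 : 0 <= y ^+ 2 / (x ^+ 2 + y ^+ 2) by rewrite divr_ge0 ?sqr_ge0// ltW.
  rewrite normrM (ger0_norm c0) normrM (ger0_norm (sqr_ge0 x)).
  have -> : x ^+ 2 * `|g x| * (y ^+ 2 / (x ^+ 2 + y ^+ 2)) =
    (y ^+ 2 * `|g x|) * (x ^+ 2 / (x ^+ 2 + y ^+ 2)) by ring.
  apply: ler_piMr; first by rewrite mulr_ge0 ?sqr_ge0.
  by rewrite ler_pdivrMr// mul1r lerDl sqr_ge0.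
- by apply: intgZ; exact: intg_norm.
Qed.

(** Integrates [kernel_lower] against g. Neither constant depends on w, so the bound is uniform
    along the flow. *)
Lemma cauchyT_lower (g : R -> R) (B : R) n : (forall x, 0 <= g x) -> intg g ->
  0 <= B -> exists C y0 : R, [/\ 0 <= C, 1 <= y0 &
  forall y w, y0 <= y -> y <= complex.Im w -> nc (w - iy y) <= B ->
  40^-1 * rint (fun x => (x ^+ 2 * g x) * (y ^+ 2 / (x ^+ 2 + y ^+ 2))) - C <=
  complex.Re (iy y ^+ n.+2 * (w^-1 ^+ n * cauchyT m (fun x => x * g x) w))].
Proof.
move=> g0 ig B0; have [C [y0 [C0 y01 h]]] := @kernel_lower B n B0.
exists (C * rint g), y0; split=> // [|y w yy0 yw wB].
  by rewrite mulr_ge0// Rintegral_ge0.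
have y0' : 0 < y by lra.
have w0 : 0 < complex.Im w by lra.
have ik := cintegrable_xcauchyT ig w0.
rewrite mulrA -cintegralM//= -!RintegralZl//; last exact: intg_cutoff.
rewrite -RintegralB//; [|exact/intgZ/intg_cutoff|exact: intgZ].
apply: le_Rintegral => //.
- rewrite (_ : _ \o _ = EFin \o (fun x => 40^-1 * ((x ^+ 2 * g x) *
    (y ^+ 2 / (x ^+ 2 + y ^+ 2))) + - C * g x)).
    by apply: intgD; [exact/intgZ/intg_cutoff|exact: intgZ].
  by apply/funext => x /=; rewrite mulNr.
- by have [] := cintegrableM (iy y ^+ n.+2 * w^-1 ^+ n) ik.
move=> x _; have := ler_wpM2r (g0 x) (h y w x yy0 yw wB).
congr (_ <= _); first by ring.
have -> : iy y ^+ n.+2 * w^-1 ^+ n * (real_complex R (x * g x) *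
    (w - real_complex R x)^-1) = (iy y ^+ n.+2 *
    (w^-1 ^+ n * (real_complex R x * (w - real_complex R x)^-1))) * real_complex R (g x).
  by rewrite rmorphM/=; ring.
by rewrite [in RHS]cReM /= mulr0 subr0.
Qed.

End Positivity.

(** * Uniqueness of real expansions *)

Section Uniqueness.
Variable R : realType.
Local Notation nc := (@Normc.normc R).

Lemma evr_bounded (r : {poly R}) : exists2 C, 0 <= C &
  forall y, 1 <= y -> nc (evr r (iy y)^-1) <= C.
Proof.
have h : expands 0 0 (fun s y => evr r (iy y)^-1).
  apply: evr_expands; apply: expands_ext (expands_ev 0 0 'X) => s y _ _.
  by rewrite evX.
have [C C0 hC] := expands_bounded h.
by exists C => // y y1; apply: (hC 0) => //; rewrite !lexx.
Qed.

Lemma evr_cons (q : {poly R}) c u :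
  evr (q * 'X + c%:P) u = evr q u * u + real_complex R c.
Proof. by rewrite /evr rmorphD rmorphM/= map_polyX map_polyC hornerMXaddC. Qed.

(** The constant term is the limit of the values, hence 0; dividing by 1/(iy) and repeating removes
    one coefficient per order. Smallness at order 0 already removes one, hence the exponent N +
    1. *)
Lemma evr_small_factor (N : nat) (r : {poly R}) :
  (forall e, 0 < e -> exists k0, forall k, (k0 <= k)%N ->
     nc (evr r (iy k.+1%:R)^-1) <= e * k.+1%:R^-1 ^+ N) ->
  exists q, r = q * 'X^(N.+1).
Proof.
have base (p : {poly R}) : (forall e, 0 < e -> exists k0, forall k, (k0 <= k)%N ->
    nc (evr p (iy k.+1%:R)^-1) <= e) -> exists q, p = q * 'X.
  elim/poly_ind: p => [|q c _ h]; first by exists 0; rewrite mul0r.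
  exists q; suff -> : c = 0 by rewrite polyC0 addr0.
  have [B B0 hB] := evr_bounded q.
  apply/normr0_eq0/eqP; rewrite eq_le normr_ge0 andbT.
  apply/ler_addgt0Pl => e e0; rewrite addr0.
  have e2 : 0 < e / 2 by rewrite divr_gt0.
  have [k1 h1] := h _ e2; have [k2 h2] := harmonic_small B e2.
  pose k := maxn k1 k2.
  have := h1 k (leq_maxl _ _); have := h2 k (leq_maxr _ _).
  have y1 : 1 <= k.+1%:R :> R by rewrite ler1n.
  set y : R := k.+1%:R in y1 *; rewrite evr_cons => a b.
  have y0 : 0 <= y by rewrite (le_trans _ y1).
  have : nc (real_complex R c) <= nc (evr q (iy y)^-1 * (iy y)^-1 + real_complex R c) +
     nc (evr q (iy y)^-1 * (iy y)^-1).
    by rewrite -{1}(addKr (evr q (iy y)^-1 * (iy y)^-1) (real_complex R c)) addrC ncB.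
  rewrite nc_real ncM nc_iyV// => /le_trans; apply.
  rewrite [leRHS]splitr lerD// (le_trans _ a)// ler_wpM2r ?invr_ge0//.
  exact: hB.
elim: N r => [|N ih] r h.
  have [|q ->] := base r; last by exists q; rewrite expr1.
  move=> e /h[k0 hk]; exists k0 => k kk0.
  by have := hk k kk0; rewrite expr0 mulr1.
have [|q rq] := base r.
  move=> e e0; have [k0 hk] := h e e0; exists k0 => k kk0.
  apply: le_trans (hk k kk0) _.
  have y1 : 1 <= k.+1%:R :> R by rewrite ler1n.
  have /andP[_ b] := @invy_le1 R _ N.+1 y1.
  by rewrite ler_piMr// ltW.
have [|p qp] := ih q; last by exists p; rewrite rq qp -mulrA -exprSr.
move=> e /h[k0 hk]; exists k0 => k kk0; have := hk k kk0.
have y1 : 1 <= k.+1%:R :> R by rewrite ler1n.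
set y : R := k.+1%:R in y1 *.
have y0 : 0 < y by rewrite (lt_le_trans _ y1).
have -> : evr r (iy y)^-1 = evr q (iy y)^-1 * (iy y)^-1.
  by rewrite -[RHS]addr0 -(rmorph0 (real_complex R)) -evr_cons polyC0 addr0 rq.
rewrite ncM nc_iyV ?(ltW y0)// exprSr mulrA ler_pM2r// invr_gt0//.
Qed.

(* The coefficients of order at most N vanish, and the one of order N + 1
   contributes a real multiple of iy, which has no real part. *)
Lemma expands_Re_bounded (T : R) (N : nat) (F : R -> R -> R[i]) (s : R) :
  expands T N.+2 F -> 0 <= s <= T ->
  (forall e, 0 < e -> exists k0, forall k, (k0 <= k)%N ->
     nc (F s k.+1%:R) <= e * k.+1%:R^-1 ^+ N) ->
  exists C, forall k, `|complex.Re (iy k.+1%:R ^+ N.+2 * F s k.+1%:R)| <= C.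
Proof.
move=> /expandsP[p [C [C0 h]]] sT small.
pose r := map_poly (horner_eval s) p.
have evE u : ev p s u = evr r u.
  by rewrite /ev /evr /r -map_poly_comp.
have [q rq] : exists q, r = q * 'X^(N.+1).
  apply: evr_small_factor => e e0; have e2 : 0 < e / 2 by rewrite divr_gt0.
  have [k1 h1] := small _ e2; have [k2 h2] := harmonic_small C e2.
  exists (maxn k1 k2) => k; rewrite geq_max => /andP[kk1 kk2].
  have y1 : 1 <= k.+1%:R :> R by rewrite ler1n.
  have := h s _ sT y1; have := h1 k kk1; have := h2 k kk2; rewrite evE.
  set y : R := k.+1%:R in y1 *; set a := F s y; set b := evr r _.
  have y0 : 0 < y by rewrite (lt_le_trans _ y1).
  move=> u1 u2 u3; have : nc b <= nc a + nc (a - b).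
    by rewrite -{1}(subKr a b) ncB.
  move=> /le_trans; apply; rewrite [e in leRHS]splitr mulrDl lerD//.
  rewrite (le_trans u3)// !exprS !mulrA ler_wpM2r ?exprn_ge0 ?invr_ge0 ?(ltW y0)//.
  apply: le_trans _ u1; apply: ler_piMr; last by rewrite invf_le1.
  by rewrite mulr_ge0// invr_ge0 ltW.
(* Only the case distinction is used: it isolates [c], the coefficient of order N + 1. *)
move: rq; elim/poly_ind: q => [|q c _] rq.
  exists C => k; have y1 : 1 <= k.+1%:R :> R by rewrite ler1n.
  have := h s _ sT y1; rewrite evE rq mul0r /evr rmorph0 horner0 subr0.
  move=> hF; rewrite (le_trans (nc_ge_Re _))// ncM ncX nc_iy ?ler0n//.
  rewrite mulrC -ler_pdivlMr ?exprn_gt0 ?ltr0n//.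
  by rewrite -exprVn.
have [D D0 hD] := evr_bounded q.
exists (D + C) => k; have y1 : 1 <= k.+1%:R :> R by rewrite ler1n.
have := h s _ sT y1; rewrite evE; set y : R := k.+1%:R in y1 *.
have y0 : 0 < y by rewrite (lt_le_trans _ y1).
have z0 := iy_neq0 y0.
have -> : evr r (iy y)^-1 = (evr q (iy y)^-1 * (iy y)^-1 + real_complex R c) * (iy y)^-1 ^+ N.+1.
  by rewrite -evr_cons rq /evr rmorphM/= hornerM map_polyXn hornerXn.
set v := evr q _; set G := F s y => hF.
have -> : iy y ^+ N.+2 * G = v + iy y * real_complex R c +
  iy y ^+ N.+2 * (G - (v * (iy y)^-1 + real_complex R c) * (iy y)^-1 ^+ N.+1).
  have zz : iy y ^+ N.+2 * (iy y)^-1 ^+ N.+1 = iy y.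
    by rewrite exprS -mulrA -exprMn mulfV// expr1n mulr1.
  rewrite mulrBr [iy y ^+ _ * (_ * _)]mulrCA zz mulrDl mulfVK//.
  by rewrite [real_complex R c * _]mulrC [RHS]addrC subrK.
rewrite !cReD (_ : complex.Re (iy y * real_complex R c) = 0); last first.
  by rewrite cReM/= mul0r mulr0 subr0.
rewrite addr0 (le_trans (ler_normD _ _))// lerD//.
  by rewrite (le_trans (nc_ge_Re _))// hD.
rewrite (le_trans (nc_ge_Re _))// ncM ncX nc_iy ?(ltW y0)//.
rewrite mulrC -ler_pdivlMr ?exprn_gt0//.
by rewrite -exprVn.
Qed.

End Uniqueness.

(** * Moments and expansions *)

Section Moments.
Variables (R : realType) (m : {measure set R -> \bar R}).
Local Notation nc := (@Normc.normc R).
Local Notation intg g := (m.-integrable setT (EFin \o (g : R -> R))).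
Local Notation rint g := (Rintegral m setT g).

Lemma normX_le_1D (x : R) k j : (k <= 2 * j)%N -> `|x| ^+ k <= 1 + x ^+ (2 * j).
Proof.
move=> kj; have xj : x ^+ (2 * j) = `|x| ^+ (2 * j).
  by rewrite !exprM real_normK ?num_real.
have [x1|/ltW x1] := leP `|x| 1.
  rewrite (@le_trans _ _ 1)// ?exprn_ile1// lerDl xj exprn_ge0//.
by rewrite (@le_trans _ _ (`|x| ^+ (2 * j)))// ?ler_weXn2l// -xj lerDr.
Qed.

Lemma intg_powM (g : R -> R) k j : (forall x, 0 <= g x) -> intg g ->
  intg (fun x => x ^+ (2 * j) * g x) -> (k <= 2 * j)%N ->
  intg (fun x => x ^+ k * g x).
Proof.
move=> g0 ig igj kj; apply: (intg_le _ _ (intgD ig igj)).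
  apply: measurable_funM; first exact: exprn_measurable.
  exact: (intg_measurable ig).
move=> x; rewrite normrM normrX (ger0_norm (g0 x)).
have := ler_wpM2r (g0 x) (normX_le_1D x kj).
by rewrite mulrDl mul1r.
Qed.

(* Fatou's lemma, applied to the truncations x^2 y^2 / (x^2 + y^2) of x^2. *)
Lemma moment_gain (g : R -> R) (N : nat) (T s : R) (F : R -> R -> R[i]) :
  (forall x, 0 <= g x) -> intg g -> 0 <= s <= T -> expands T N.+2 F ->
  (forall y, 1 <= y ->
     F s y = (iy y)^-1 ^+ N * cauchyT m (fun x => x * g x) (iy y)) ->
  intg (fun x => x ^+ 2 * g x).
Proof.
move=> g0 ig sT hF FE.
have [C hC] : exists C, forall k, `|complex.Re (iy k.+1%:R ^+ N.+2 * F s k.+1%:R)| <= C.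
  apply: expands_Re_bounded hF sT _ => e e0.
  have [k0 hk] := cauchyT_small ig (@ler01 R) e0.
  exists k0 => k kk0; have y1 : 1 <= k.+1%:R :> R by rewrite ler1n.
  rewrite FE// ncM ncX nc_iyV ?ler0n// mulrC ler_wpM2r ?exprn_ge0 ?invr_ge0//.
  by apply: (hk k kk0); [exact: lexx|rewrite nc_iy ?mul1r ?ler0n].
(* The kernel bound is needed only at w = iy, so the allowed distance from iy is 0. *)
have [D [y0 [D0 y01 hD]]] := @cauchyT_lower R m g 0 N g0 ig (lexx 0).
apply: (@integrable_fatou _ _ _ (40 * (C + D)) (Num.bound y0)).
- by move=> x; rewrite mulr_ge0 ?sqr_ge0.
- apply: measurable_funM; first exact: exprn_measurable.
  exact: (intg_measurable ig).
- by move=> k; apply: intg_cutoff => //; rewrite ltr0n.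
move=> k kk0; have y1 : 1 <= k.+1%:R :> R by rewrite ler1n.
have yy0 : y0 <= k.+1%:R.
  rewrite (le_trans (ltW (archi_boundP _)))//; first by rewrite (le_trans ler01).
  by rewrite ler_nat (leq_trans kk0).
have := hD _ (iy k.+1%:R) yy0 (lexx _); rewrite subrr nc0 => /(_ (lexx _)).
rewrite -FE//; have := hC k; set r := rint _.
by rewrite ler_norml => /andP[_ ?] ?; lra.
Qed.

End Moments.

(** * Size and imaginary part of the reciprocal Cauchy transform of a probability measure *)

Section Probability.
Variables (R : realType) (mu : probability R R).
Local Notation nc := (@Normc.normc R).
Local Notation intg g := (mu.-integrable setT (EFin \o (g : R -> R))).
Local Notation rint g := (Rintegral mu setT g).

Lemma cauchyG_T z : cauchyG mu z = cauchyT mu (cst 1) z.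
Proof.
by rewrite /cauchyG /cauchyT; congr cintegral; apply/funext => x; rewrite mul1r.
Qed.

Lemma intg_cst (c : R) : intg (cst c).
Proof. exact: finite_measure_integrable_cst. Qed.

Lemma rint_cst (c : R) : rint (cst c) = c.
Proof.
rewrite Rintegral_cst// [X in fine X](_ : _ = 1%E) ?mulr1//.
exact: probability_setT.
Qed.

Lemma intg_bounded (f : R -> R) C : measurable_fun setT f ->
  (forall x, `|f x| <= C) -> intg f.
Proof. by move=> mf fC; apply: intg_le fC (intg_cst C). Qed.

Lemma cutoff_ge0_le1 (y x : R) : 0 < y -> 0 <= y ^+ 2 / (x ^+ 2 + y ^+ 2) <= 1.
Proof.
move=> y0; have q0 : 0 < x ^+ 2 + y ^+ 2 by rewrite ltr_wpDl ?sqr_ge0// exprn_gt0.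
rewrite divr_ge0 ?sqr_ge0 ?(ltW q0)//= ler_pdivrMr// mul1r lerDr sqr_ge0//.
Qed.

Lemma intg_cutoff1 (y : R) : 0 < y -> intg (fun x => y ^+ 2 / (x ^+ 2 + y ^+ 2)).
Proof.
move=> y0; apply: (@intg_bounded _ 1); first exact: measurable_cutoff.
by move=> x; have /andP[? ?] := cutoff_ge0_le1 x y0; rewrite ger0_norm.
Qed.

(** The integrand is positive everywhere; a zero integral would make the whole line negligible,
    against total mass 1. *)
Lemma cutoff_integral_gt0 : 0 < rint (fun x => 1 ^+ 2 / (x ^+ 2 + 1 ^+ 2)).
Proof.
set f := fun x : R => _.
have f0 x : 0 < f x by rewrite divr_gt0 ?exprn_gt0// ltr_wpDl ?sqr_ge0// exprn_gt0.
have I0 : 0 <= rint f by apply: Rintegral_ge0 => x _; exact/ltW/f0.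
rewrite lt_neqAle I0 andbT.
have if_ : intg f by apply: intg_cutoff1.
apply/negP => /eqP f00.
have mf : measurable_fun setT (EFin \o f) by case/integrableP : if_.
have : (\int[mu]_x `|(EFin \o f) x| = 0)%E.
  rewrite (_ : (fun x => _) = EFin \o f).
    by rewrite -[LHS]fineK; [congr EFin|exact: integrable_fin_num].
  by apply/funext => x /=; rewrite gtr0_norm.
move=> /(ae_eq_integral_abs mu measurableT mf) h.
have /negligibleP : mu.-negligible (setT : set R).
  apply: negligibleS h => x _ /= /(_ I) /eqP.
  by rewrite eqe gt_eqF.
move=> /(_ measurableT) /esym.
by rewrite [X in _ = X](probability_setT mu) => /esym/eqP; rewrite onee_eq0.
Qed.

Lemma ImG_iy y : 0 < y ->
  - complex.Im (cauchyG mu (iy y)) * y = rint (fun x => y ^+ 2 / (x ^+ 2 + y ^+ 2)).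
Proof.
move=> y0; rewrite /cauchyG /= mulNr -mulrN mulrC -RintegralZl//; last first.
  have := (cintegrable_cauchyT (intg_cst 1) (w := iy y) y0).2.
  by apply: eq_integrable => // x _ /=; rewrite mul1r mul0r !addr0.
by apply: eq_Rintegral => x _; rewrite /= ?oppr0 ?addr0 ?sub0r ?add0r sqrrN; field;
  rewrite gt_eqF// ltr_wpDl ?sqr_ge0// exprn_gt0.
Qed.

(** y |G(iy)| is at least - y Im G(iy) = int y^2/(x^2 + y^2), which grows with y and so exceeds its
    value at y = 1. *)
Lemma ncH_iy_le y : 1 <= y -> cauchyG mu (iy y) != 0 /\
  nc (cauchyH mu (iy y)) <= y / rint (fun x => 1 ^+ 2 / (x ^+ 2 + 1 ^+ 2)).
Proof.
move=> y1; have y0 : 0 < y by rewrite (lt_le_trans _ y1).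
have k0 := cutoff_integral_gt0; set kappa := Rintegral _ _ _ in k0 *.
have h : kappa <= nc (cauchyG mu (iy y)) * y.
  apply: (@le_trans _ _ (- complex.Im (cauchyG mu (iy y)) * y)); last first.
    by rewrite ler_pM2r// (le_trans (ler_norm _))// normrN nc_ge_Im.
  rewrite ImG_iy//; apply: le_Rintegral => //; try exact: intg_cutoff1.
  move=> x _; have y2 : 1 <= y ^+ 2 by rewrite exprn_ege1.
  have x2 := sqr_ge0 x; rewrite expr1n ler_pdivrMr; last by lra.
  rewrite mulrAC ler_pdivlMr ?mul1r; last by lra.
  by have : 0 <= x ^+ 2 * (y ^+ 2 - 1) by [rewrite mulr_ge0// subr_ge0]; lra.
have G0 : 0 < nc (cauchyG mu (iy y)) by rewrite -(pmulr_lgt0 _ y0) (lt_le_trans k0).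
rewrite -nc_gt0 G0; split=> //.
by rewrite /cauchyH ncV ler_pdivlMr// mulrC ler_pdivrMr// [leRHS]mulrC.
Qed.

(* Jensen: |int f|^2 <= int |f|^2 for f(x) = 1/(z - x), and |f|^2 = - Im f / Im z. *)
Lemma ImH_ge z : 0 < complex.Im z -> cauchyG mu z != 0 ->
  complex.Im z <= complex.Im (cauchyH mu z).
Proof.
move=> z0 G0; pose p x := complex.Re ((z - real_complex R x)^-1).
pose q x := complex.Im ((z - real_complex R x)^-1).
have [ip iq] : intg p /\ intg q.
  have [i1 i2] := cintegrable_cauchyT (intg_cst 1) z0.
  by split; [move: i1|move: i2]; apply: eq_integrable => // x _; rewrite /= mul1r.
(* Nonnegativity of the variance: (f - a)^2 is expanded with a the mean of f, using total mass 1. *)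
have var (f : R -> R) C : intg f -> (forall x, `|f x| <= C) ->
    intg (fun x => f x ^+ 2) /\ (rint f) ^+ 2 <= rint (fun x => f x ^+ 2).
  move=> if_ fC; have if2 : intg (fun x => f x ^+ 2).
    apply: (@intg_bounded _ (C ^+ 2)).
      by apply: measurable_funX; exact: (intg_measurable if_).
    by move=> x; rewrite normrX lerXn2r ?nnegrE// (le_trans _ (fC x)).
  split => //; set a := rint f.
  have : 0 <= rint (fun x => f x ^+ 2 + (- (2 * a) * f x + a ^+ 2)).
    apply: Rintegral_ge0 => x _.
    have -> : f x ^+ 2 + (- (2 * a) * f x + a ^+ 2) = (f x - a) ^+ 2 by ring.
    exact: sqr_ge0.
  rewrite RintegralD//; last by apply: intgD; [exact: intgZ|exact: (intg_cst (a ^+ 2))].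
  rewrite RintegralD//; [|exact: intgZ|exact: (intg_cst (a ^+ 2))].
  rewrite RintegralZl// -/a (rint_cst (a ^+ 2)).
  have -> : - (2 * a) * a + a ^+ 2 = - a ^+ 2 by ring.
  by rewrite subr_ge0.
have bnd x : nc (z - real_complex R x)^-1 <= (complex.Im z)^-1 by exact: nc_resolvent_le.
have [ip2 vp] := var p _ ip (fun x => le_trans (nc_ge_Re _) (bnd x)).
have [iq2 vq] := var q _ iq (fun x => le_trans (nc_ge_Im _) (bnd x)).
have sumE : rint (fun x => p x ^+ 2) + rint (fun x => q x ^+ 2) =
    - (complex.Im z)^-1 * rint q.
  rewrite -RintegralD// -RintegralZl//; apply: eq_Rintegral => x _.
  rewrite /p /q -nc_sqr ncV exprVn nc_sqr cImV cImD cImN /= subr0.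
  by field; rewrite !gt_eqF// ltr_wpDl ?sqr_ge0// exprn_gt0.
have GE : cauchyG mu z = Complex (rint p) (rint q) by [].
rewrite /cauchyH cImV GE /=.
have d0 : 0 < rint p ^+ 2 + rint q ^+ 2.
  have -> : rint p ^+ 2 + rint q ^+ 2 = nc (cauchyG mu z) ^+ 2 by rewrite nc_sqr GE.
  by rewrite exprn_gt0// nc_gt0.
rewrite ler_pdivlMr//.
have : rint p ^+ 2 + rint q ^+ 2 <= - (complex.Im z)^-1 * rint q.
  by rewrite -sumE lerD.
by move=> /(ler_wpM2l (ltW z0)); rewrite mulrA mulrN mulfV ?gt_eqF// mulN1r.
Qed.

Lemma ImH_iy_ge y : 1 <= y -> y <= complex.Im (cauchyH mu (iy y)).
Proof.
move=> y1; apply: (@ImH_ge (iy y)); first by rewrite /= (lt_le_trans _ y1).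
by have [] := ncH_iy_le y1.
Qed.

End Probability.

(** * From moments to expansions of Cauchy transforms *)

Section MomentExpansions.
Variables (R : realType) (m : {measure set R -> \bar R}).
Local Notation nc := (@Normc.normc R).
Local Notation intg g := (m.-integrable setT (EFin \o (g : R -> R))).

Lemma moment_integrableP n :
  (\int[m]_x (x ^+ (2 * n))%:E < +oo)%E <-> intg (fun x => x ^+ (2 * n)).
Proof.
have x0 (x : R) : 0 <= x ^+ (2 * n) by rewrite exprM exprn_ge0// sqr_ge0.
have absE : (fun x : R => `|(EFin \o (fun x : R => (x ^+ (2 * n))%R)) x|)%E =
    (fun x : R => (x ^+ (2 * n))%:E).
  by apply/funext => x /=; rewrite ger0_norm.
split=> [h|/integrableP[_]]; last by rewrite absE.
apply/integrableP; split; last by rewrite absE.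
by apply/measurable_EFinP; exact: exprn_measurable.
Qed.

(** Evaluating the coefficients at s gives an expansion constant in time, the form used for a single
    measure. *)
Lemma expands_freeze (T : R) k F s : expands T k F -> 0 <= s <= T ->
  expands T k (fun _ => F s).
Proof.
move=> [p [C h]] sT; exists (map_poly (polyC \o horner_eval s) p), C => t y _ y1.
have -> : ev (map_poly (polyC \o horner_eval s) p) t (iy y)^-1 = ev p s (iy y)^-1.
  rewrite /ev -map_poly_comp; congr horner; apply: eq_map_poly => c /=.
  by rewrite /horner_eval hornerC.
exact: h.
Qed.

(** The Taylor remainder of order N + 1 carries the weight x^(N+1) g, which need not be integrable;
    [cauchyT_remainder] controls it by the moment of order N. *)
Lemma cauchyT_expands (T : R) (g : R -> R) N :
  (forall k, (k <= N)%N -> intg (fun x => x ^+ k * g x)) ->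
  expands T N.+1 (fun _ y => cauchyT m g (iy y)).
Proof.
move=> ig; have [P hP] := @cauchyT_taylor R m g N.+1 (fun k kN => ig k (ltnSE kN)).
have [C hC] := cauchyT_remainder (ig N (leqnn N)).
have [p [D hD]] : expands T N.+1 (fun s y => evr P (iy y)^-1).
  apply: evr_expands; apply: expands_ext (expands_ev T _ 'X) => s y _ _.
  by rewrite evX.
exists p, (D + C) => s y sT y1; have y0 : 0 < y by rewrite (lt_le_trans _ y1).
rewrite hP//= addrAC (le_trans (ncD _ _))// mulrDl lerD ?hD//.
exact: hC.
Qed.

End MomentExpansions.

(** * The Hamburger-Nevanlinna equivalence for H *)

Section ReciprocalTransform.
Variables (R : realType) (mu : probability R R).
Local Notation nc := (@Normc.normc R).
Local Notation intg g := (mu.-integrable setT (EFin \o (g : R -> R))).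
Local Notation rint g := (Rintegral mu setT g).

Lemma intg_moment_le k n : intg (fun x => x ^+ (2 * n)) -> (k <= 2 * n)%N ->
  intg (fun x => x ^+ k).
Proof.
move=> i2n kn.
have := @intg_powM R mu (cst 1) k n (fun=> ler01) (intg_cst mu 1) _ kn.
rewrite (_ : (fun x => x ^+ (2 * n) * cst 1 x) = (fun x => x ^+ (2 * n))); last first.
  by apply/funext => x; rewrite mulr1.
rewrite (_ : (fun x => x ^+ k * cst 1 x) = (fun x => x ^+ k)); last first.
  by apply/funext => x; rewrite mulr1.
exact.
Qed.

(* H = z / (1 + g / z) with g = m_1 + int x^2 / (z - x) *)
Lemma moment_H_expands (T : R) j : intg (fun x => x ^+ (2 * j.+1)) ->
  expands T (2 * j).+1 (fun _ y => cauchyH mu (iy y) - iy y).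
Proof.
move=> i2; have ik k (kj : (k <= 2 * j.+1)%N) := intg_moment_le i2 kj.
have i1 : intg (fun x => x * cst 1 x).
  rewrite (_ : (fun x => _) = (fun x => x ^+ 1)); first by apply: ik; rewrite mulnS.
  by apply/funext => x; rewrite mulr1 expr1.
pose g2 (x : R) := x * (x * cst 1 x).
pose m1 := rint (fun x => x * cst 1 x).
pose g (s y : R) := real_complex R m1 + cauchyT mu g2 (iy y).
have GE y : 1 <= y -> cauchyG mu (iy y) = (iy y)^-1 * (1 + (iy y)^-1 * g 0 y).
  move=> y1; have y0 : 0 < y by rewrite (lt_le_trans _ y1).
  rewrite cauchyG_T (cauchyT_step (intg_cst mu 1))// (cauchyT_step i1)//.
  by rewrite [X in real_complex R X](rint_cst mu 1) rmorph1.
have hg : expands T (2 * j).+1 g.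
  apply: expandsD.
    apply: expands_ext (expands_ev T _ (m1%:P)%:P) => s y _ _.
    by rewrite evC hornerC.
  apply: cauchyT_expands => k kj.
  rewrite (_ : (fun x => _) = (fun x => x ^+ k.+2)); last first.
    by apply/funext => x; rewrite /g2 mulr1 -expr2 -exprD addn2.
  by apply: ik; rewrite mulnS add2n !ltnS.
have d0 s y : 0 <= s <= T -> 1 <= y -> 1 + (iy y)^-1 * g s y != 0.
  move=> _ y1; have [+ _] := ncH_iy_le mu y1.
  by rewrite GE//; apply: contraNneq => ->; rewrite mulr0.
have y1z (y : R) : 1 <= y -> iy y != 0 by move=> y1; rewrite iy_neq0// (lt_le_trans _ y1).
have HE y : 1 <= y -> cauchyH mu (iy y) = iy y * (1 + (iy y)^-1 * g 0 y)^-1.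
  by move=> y1; rewrite /cauchyH GE// invfM invrK.
have k0 := cutoff_integral_gt0 mu.
(* The inverse to be bounded is H/(iy), so the constant is that of [ncH_iy_le]. *)
have hinv := expands_inv hg d0 (C := (rint (fun x => 1 ^+ 2 / (x ^+ 2 + 1 ^+ 2)))^-1).
have {}hinv : expands T (2 * j).+2 (fun s y => (1 + (iy y)^-1 * g s y)^-1).
  apply: hinv => s y _ y1; have [_] := ncH_iy_le mu y1.
  have y0 : 0 < y by rewrite (lt_le_trans _ y1).
  by rewrite HE// ncM nc_iy ?(ltW y0)// ler_pM2l.
(* Uses H - z = - g/(1 + g/z) at z = iy. *)
apply: expands_ext (expandsN (expandsM hg (expandsW (leqnSn _) hinv))) => s y sT y1.
have := d0 s y sT y1; have := y1z y y1; rewrite HE//.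
have -> : g s y = g 0 y by [].
move: (g 0 y) (iy y) => a z z0 za0.
have -> : (1 + z^-1 * a)^-1 = z / (z + a).
  have za : z + a = z * (1 + z^-1 * a) by rewrite mulrDr mulr1 mulrA mulfV ?mul1r.
  by rewrite za invfM mulrA mulfV// mul1r.
have za : z + a != 0.
  by have -> : z + a = z * (1 + z^-1 * a); rewrite ?mulf_neq0// mulrDr mulr1 mulrA mulfV ?mul1r.
by field.
Qed.

(** Inverting H, with Im H >= y as control, expands G two orders further. The even moments are then
    gained one after another: subtracting from G its Taylor polynomial leaves the exact remainder
    that [moment_gain] requires. *)
Lemma H_expands_moment (T : R) j : 0 <= T ->
  expands T (2 * j).+1 (fun _ y => cauchyH mu (iy y) - iy y) ->
  intg (fun x => x ^+ (2 * j.+1)).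
Proof.
move=> T0 hH; have y1z (y : R) : 1 <= y -> iy y != 0.
  by move=> y1; rewrite iy_neq0// (lt_le_trans _ y1).
have E y : 1 <= y -> 1 + (iy y)^-1 * (cauchyH mu (iy y) - iy y) =
    (iy y)^-1 * cauchyH mu (iy y).
  by move=> y1; rewrite mulrBr (mulVf (y1z y y1)) [LHS]addrC subrK.
have H0 y : 1 <= y -> cauchyH mu (iy y) != 0.
  by move=> y1; rewrite invr_eq0; have [] := ncH_iy_le mu y1.
have hG : expands T (2 * j).+3 (fun _ y => cauchyG mu (iy y)).
  have := expands_inv hH _ _ (C := 1).
  case=> [s y _ y1|s y _ y1|p [C hC]].
  - by rewrite E//; apply: mulf_neq0; [rewrite invr_eq0; exact: y1z|exact: H0].
  - have y0 : 0 < y by rewrite (lt_le_trans _ y1).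
    rewrite E// invfM invrK ncM nc_iy ?(ltW y0)// ncV ler_pdivrMr ?nc_gt0 ?H0// mul1r.
    by rewrite (le_trans (ImH_iy_ge mu y1))// (le_trans (ler_norm _))// nc_ge_Im.
  apply: expands_ext (expandsMu (ex_intro _ p (ex_intro _ C hC))) => s y _ y1.
  by rewrite E// invfM invrK mulrA mulVf ?y1z// mul1r invrK.
suff h i : (i <= j.+1)%N -> intg (fun x => x ^+ (2 * i)) by exact: h.
elim: i => [_|i ih ij].
  rewrite (_ : (fun x => _) = cst 1); first exact: intg_cst.
  by apply/funext => x; rewrite expr0.
have ii := ih (ltnW ij).
have [P hP] : exists P : {poly R}, forall w, 0 < complex.Im w ->
    cauchyT mu (cst 1) w = evr P w^-1 +
      w^-1 ^+ (2 * i).+1 * cauchyT mu (fun x => x ^+ (2 * i).+1 * cst 1 x) w.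
  apply: cauchyT_taylor => k ki.
  rewrite (_ : (fun x => _) = (fun x => x ^+ k)); last by apply/funext => x; rewrite mulr1.
  by apply: intg_moment_le ii _.
have -> : (fun x : R => x ^+ (2 * i.+1)) = (fun x => x ^+ 2 * x ^+ (2 * i)).
  by apply/funext => x; rewrite mulnS exprD.
pose F (s y : R) := (iy y)^-1 ^+ (2 * i).+1 * cauchyT mu (fun x => x * x ^+ (2 * i)) (iy y).
apply: (@moment_gain _ _ _ (2 * i).+1 T 0 F) => //.
- by move=> x; rewrite exprM exprn_ge0// sqr_ge0.
- by rewrite lexx.
have hG' : expands T (2 * i).+3 (fun _ y => cauchyG mu (iy y)).
  by apply: expandsW hG; rewrite !ltnS leq_mul2l /= -ltnS.
have hP' : expands T (2 * i).+3 (fun _ y => evr P (iy y)^-1).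
  apply: evr_expands; apply: expands_ext (expands_ev T _ 'X) => s y _ _.
  by rewrite evX.
apply: expands_ext (expandsD hG' (expandsN hP')) => s y _ y1.
have y0 : 0 < y by rewrite (lt_le_trans _ y1).
rewrite cauchyG_T hP// addrAC subrr add0r /F.
rewrite (_ : (fun x => x ^+ _ * _) = (fun x => x * x ^+ (2 * i)))//.
by apply/funext => x; rewrite mulr1 exprS.
Qed.

End ReciprocalTransform.

(** * The generator *)

Section Generator.
Variables (R : realType) (gamma : R) (tau : {finite_measure set R -> \bar R}).
Local Notation nc := (@Normc.normc R).
Local Notation intg g := (tau.-integrable setT (EFin \o (g : R -> R))).
Local Notation rint g := (Rintegral tau setT g).

Lemma tau_intg_cst (c : R) : intg (cst c).
Proof. exact: finite_measure_integrable_cst. Qed.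

Lemma intg_Dsqr : intg (fun x => x ^+ 2) -> intg (fun x => 1 + x ^+ 2).
Proof. by move=> i2; apply: intgD => //; exact: (tau_intg_cst 1). Qed.

(** From (1 + x w)/(x - w) = - x - (1 + x^2)/(w - x); the second moment makes both terms separately
    integrable. *)
Lemma generatorA_cauchyT w : intg (fun x => x ^+ 2) -> 0 < complex.Im w ->
  generatorA gamma tau w = - real_complex R (gamma + rint id)
     - cauchyT tau (fun x => 1 + x ^+ 2) w.
Proof.
move=> i2 w0; rewrite /generatorA.
have i1 : intg id.
  apply: (intg_le _ _ (intg_Dsqr i2)) => //.
  move=> x; rewrite -[X in _ <= 1 + X]real_normK ?num_real//.
  by have := sqr_ge0 (`|x| - 1); rewrite sqrrB1; have := normr_ge0 x; lra.
have -> : (fun x : R => (1 + real_complex R x * w) / (real_complex R x - w)) =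
  (fun x => -1 * real_complex R x + -1 * (real_complex R (1 + x ^+ 2) *
     (w - real_complex R x)^-1)).
  apply/funext => x; rewrite rmorphD rmorph1 rmorphXn/=.
  have h := subr_real_neq0 x w0.
  have -> : real_complex R x - w = - (w - real_complex R x) by rewrite opprB.
  move: (real_complex R x) h => X h; rewrite invrN.
  by field.
rewrite cintegralD; first last.
- exact/cintegrableM/cintegrable_cauchyT/w0/intg_Dsqr.
- exact/cintegrableM/cintegrable_real.
rewrite !cintegralM; first last.
- exact: cintegrable_real.
- exact/cintegrable_cauchyT/w0/intg_Dsqr.
by rewrite cintegral_real rmorphD/= !mulN1r opprD addrA.
Qed.

Lemma intg_weight k j : intg (fun x => x ^+ (2 * j.+1)) -> (k <= 2 * j)%N ->
  intg (fun x => x ^+ k * (1 + x ^+ 2)).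
Proof.
move=> ij kj; have i1 := tau_intg_cst 1.
have pw l : (l <= 2 * j.+1)%N -> intg (fun x => x ^+ l).
  move=> lj; have := @intg_powM R tau (cst 1) l j.+1 (fun=> ler01) i1 _ lj.
  rewrite (_ : (fun x => x ^+ (2 * j.+1) * cst 1 x) = (fun x => x ^+ (2 * j.+1))); last first.
    by apply/funext => x; rewrite mulr1.
  rewrite (_ : (fun x => x ^+ l * cst 1 x) = (fun x => x ^+ l)); last first.
    by apply/funext => x; rewrite mulr1.
  exact.
rewrite (_ : (fun x => _) = (fun x => x ^+ k + x ^+ k.+2)).
  apply: intgD; apply: pw; rewrite mulnS add2n ?ltnS//.
  by rewrite (leq_trans kj)// leqW.
by apply/funext => x; rewrite mulrDr mulr1 -exprD addn2.
Qed.

(** The weight 1 + x^2 uses up two of the 2j + 2 moments of tau, so the Taylor expansion stops at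
    order 2j + 1. *)
Lemma generatorA_taylor j : intg (fun x => x ^+ (2 * j.+1)) ->
  exists P : {poly R}, forall w, 0 < complex.Im w ->
    generatorA gamma tau w = evr P w^-1 - w^-1 ^+ (2 * j).+1 *
      cauchyT tau (fun x => x ^+ (2 * j).+1 * (1 + x ^+ 2)) w.
Proof.
move=> ij; have i2 : intg (fun x => x ^+ 2).
  have := @intg_powM R tau (cst 1) 2 j.+1 (fun=> ler01) (tau_intg_cst 1).
  rewrite (_ : (fun x => x ^+ (2 * j.+1) * cst 1 x) = (fun x => x ^+ (2 * j.+1))); last first.
    by apply/funext => x; rewrite mulr1.
  rewrite (_ : (fun x => x ^+ 2 * cst 1 x) = (fun x => x ^+ 2)); last first.
    by apply/funext => x; rewrite mulr1.
  by apply => //; rewrite mulnS leq_addr.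
have [P hP] := @cauchyT_taylor R tau (fun x => 1 + x ^+ 2) (2 * j).+1
  (fun k kj => intg_weight ij (ltnSE kj)).
exists (- (gamma + rint id)%:P - P) => w w0.
rewrite generatorA_cauchyT// hP// opprD addrA; congr (_ - _).
by rewrite /evr rmorphB rmorphN/= map_polyC hornerD !hornerN hornerC.
Qed.

(* (1 + x w) / (x - w) = w - (1 + w^2) / (w - x) *)
Lemma ImA_lower w y : 1 <= y -> y <= complex.Im w -> nc w <= 2 * y ->
  (8 * y)^-1 * rint (fun x => (1 + x ^+ 2) * (y ^+ 2 / (x ^+ 2 + y ^+ 2)))
    <= complex.Im (generatorA gamma tau w).
Proof.
move=> y1 yw wy; have y0 : 0 < y by rewrite (lt_le_trans _ y1).
have w0 : 0 < complex.Im w by rewrite (lt_le_trans y0).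
have i1 := tau_intg_cst 1.
have ic : cintegrable tau (fun x => (1 + real_complex R x * w) / (real_complex R x - w)).
  rewrite (_ : (fun x => _) = (fun x => w * real_complex R (cst 1 x) + - (1 + w ^+ 2) *
     (real_complex R (cst 1 x) * (w - real_complex R x)^-1))).
    apply: cintegrableD; apply: cintegrableM; first exact: cintegrable_real.
    exact: cintegrable_cauchyT.
  apply/funext => x; rewrite /= rmorph1 mulr1 mul1r.
  have h := subr_real_neq0 x w0.
  have -> : real_complex R x - w = - (w - real_complex R x) by rewrite opprB.
  move: (real_complex R x) h => X h; rewrite invrN.
  by field.
have icut : intg (fun x => (1 + x ^+ 2) * (y ^+ 2 / (x ^+ 2 + y ^+ 2))).
  apply: (intg_le _ _ (tau_intg_cst (y ^+ 2))).
    apply: measurable_funM; last exact: measurable_cutoff.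
    by apply: measurable_funD => //; exact: exprn_measurable.
  move=> x; have q0 : 0 < x ^+ 2 + y ^+ 2 by rewrite ltr_wpDl ?sqr_ge0// exprn_gt0.
  have x0 := sqr_ge0 x; rewrite ger0_norm.
    rewrite mulrCA ler_piMr ?sqr_ge0// ler_pdivrMr// mul1r addrC lerD2l.
    by rewrite exprn_ege1.
  by rewrite mulr_ge0 ?addr_ge0// divr_ge0 ?sqr_ge0// ltW.
rewrite /generatorA cImD cImN /= oppr0 add0r -RintegralZl//.
apply: le_Rintegral => //; [exact: intgZ|exact: ic.2|move=> x _].
have -> : complex.Im ((1 + real_complex R x * w) / (real_complex R x - w)) =
    (1 + x ^+ 2) * (complex.Im w / nc (w - real_complex R x) ^+ 2).
  rewrite nc_sqr; case: w {yw wy ic} w0 => a b /= b0.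
  have d0 : (a - x) ^+ 2 + b ^+ 2 != 0.
    by rewrite gt_eqF// ltr_wpDl ?sqr_ge0// exprn_gt0.
  have d1 : (x - a) ^+ 2 + (0 - b) ^+ 2 = (a - x) ^+ 2 + b ^+ 2 by ring.
  have d2 : (x - a) ^+ 2 + (- b) ^+ 2 = (a - x) ^+ 2 + b ^+ 2 by ring.
  rewrite ?(sub0r, add0r, oppr0, addr0) ?d1 ?d2.
  by field.
rewrite mulrCA ler_wpM2l//; first by rewrite addr_ge0 ?sqr_ge0.
have N0 : 0 < nc (w - real_complex R x) by rewrite nc_gt0 subr_real_neq0.
(* From |w - x| <= 2 y + |x|, whose square is at most 8 y^2 + 2 x^2. *)
have N2 : nc (w - real_complex R x) ^+ 2 <= 8 * (x ^+ 2 + y ^+ 2).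
  have h : nc (w - real_complex R x) <= 2 * y + `|x|.
    by rewrite (le_trans (ncB _ _))// nc_real lerD2r.
  have : nc (w - real_complex R x) ^+ 2 <= (2 * y + `|x|) ^+ 2.
    by rewrite lerXn2r ?nnegrE ?nc_ge0 ?addr_ge0 ?mulr_ge0 ?(ltW y0).
  move=> /le_trans; apply; rewrite sqrrD exprMn real_normK ?num_real//.
  have e : (2 * y - `|x|) ^+ 2 = 4 * y ^+ 2 - 4 * (y * `|x|) + x ^+ 2.
    by rewrite sqrrB exprMn real_normK ?num_real//; ring.
  have : 0 <= (2 * y - `|x|) ^+ 2 by rewrite sqr_ge0.
  have x2 := sqr_ge0 x.
  have -> : 2 * y * `|x| *+ 2 = 4 * (y * `|x|) by ring.
  have -> : 2 ^+ 2 = 4 :> R by ring.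
  by rewrite e; lra.
have q0 : 0 < x ^+ 2 + y ^+ 2 by rewrite ltr_wpDl ?sqr_ge0// exprn_gt0.
have -> : (8 * y)^-1 * (y ^+ 2 / (x ^+ 2 + y ^+ 2)) = y / (8 * (x ^+ 2 + y ^+ 2)).
  by field; rewrite !gt_eqF.
rewrite ler_pM ?(ltW y0)//; first by rewrite invr_ge0 mulr_ge0// ltW.
by rewrite lef_pV2 ?posrE ?exprn_gt0// mulr_gt0.
Qed.

End Generator.

(** * The semigroup *)

Section Semigroup.
Variables (R : realType) (mu : R -> probability R R) (gamma : R).
Variable tau : {finite_measure set R -> \bar R}.
Local Notation nc := (@Normc.normc R).
Local Notation H := (fun s y => cauchyH (mu s) (iy y)).
Local Notation A := (generatorA gamma tau).
Local Notation intgt g := (tau.-integrable setT (EFin \o (g : R -> R))).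
Hypothesis mu_wc : weakly_continuous mu.
Hypothesis mu0 : forall A : set R, measurable A -> mu 0 A = \d_(0 : R) A.
Hypothesis mu_sg : monotone_semigroup mu.
Hypothesis mu_gen : associated_pair mu gamma tau.

Lemma Rintegral_mu0 (f : R -> R) : measurable_fun setT f ->
  Rintegral (mu 0) setT f = f 0.
Proof.
move=> mf; rewrite /Rintegral.
rewrite (@eq_measure_integral _ _ _ setT (\d_(0 : R)) (mu 0)); last first.
  by move=> B mB _; exact: mu0.
rewrite integral_dirac//; last exact/measurable_EFinP.
by rewrite diracE in_setT mul1e.
Qed.

Lemma cauchyH_mu0 z : 0 < complex.Im z -> cauchyH (mu 0) z = z.
Proof.
move=> z0; have [m1 m2] := cmeasurable_resolvent z0.
rewrite /cauchyH /cauchyG /cintegral !Rintegral_mu0//.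
rewrite (_ : Complex _ _ = z^-1) ?invrK// rmorph0 subr0.
by case: z^-1.
Qed.

(** The real and imaginary parts of the resolvent are bounded and continuous, hence test functions
    for weak continuity. *)
Lemma cauchyG_continuous (T y : R) : 0 < y ->
  ccontinuous `[0, T] (fun s => cauchyG (mu s) (iy y)).
Proof.
move=> y0; have [c1 c2] := @continuous_resolvent R (iy y) y0.
have sub : `[0, T] `<=` [set t : R | 0 <= t].
  by move=> x /=; rewrite in_itv/= => /andP[].
have b x : nc (iy y - real_complex R x)^-1 <= y^-1 by exact: (@nc_resolvent_le R (iy y)).
split; apply: continuous_subspaceW sub _; apply: mu_wc => //; exists y^-1 => x.
  exact: le_trans (nc_ge_Re _) (b x).
exact: le_trans (nc_ge_Im _) (b x).
Qed.

Lemma flow_continuous (T y : R) : 1 <= y -> ccontinuous `[0, T] (H ^~ y).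
Proof.
move=> y1; have [c1 c2] := @cauchyG_continuous T y (lt_le_trans ltr01 y1).
pose d s := complex.Re (cauchyG (mu s) (iy y)) ^+ 2 + complex.Im (cauchyG (mu s) (iy y)) ^+ 2.
have d0 s : d s != 0.
  by rewrite /d -nc_sqr expf_neq0// gt_eqF// nc_gt0; have [] := ncH_iy_le (mu s) y1.
have cd : {within `[0, T], continuous (fun s => (d s)^-1)}.
  move=> x; apply: cvgV => //.
  rewrite (_ : d = fun s => complex.Re (cauchyG (mu s) (iy y)) * complex.Re (cauchyG (mu s) (iy y))
    + complex.Im (cauchyG (mu s) (iy y)) * complex.Im (cauchyG (mu s) (iy y))).
    by apply: cvgD; apply: cvgM; [exact: c1|exact: c1|exact: c2|exact: c2].
  by apply/funext => s; rewrite /d !expr2.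
split.
  rewrite (_ : (fun t => _) = fun s => complex.Re (cauchyG (mu s) (iy y)) * (d s)^-1).
    by move=> x; apply: cvgM; [exact: c1|exact: cd].
  by apply/funext => s; rewrite /cauchyH cReV.
rewrite (_ : (fun t => _) = fun s => (- complex.Im (cauchyG (mu s) (iy y))) * (d s)^-1).
  by move=> x; apply: cvgM; [apply: cvgN; exact: c2|exact: cd].
by apply/funext => s; rewrite /cauchyH cImV.
Qed.

Lemma flow_derive s y : 0 < s -> 1 <= y -> cderiv (H ^~ y) s (A (H s y)).
Proof.
move=> s0 y1; have [|d1 d2] := mu_gen (z := iy y) _ s0.
  by rewrite /= gt_eqF// (lt_le_trans _ y1).
by split.
Qed.

Lemma flow_at0 y : 1 <= y -> H 0 y = iy y.
Proof. by move=> y1; apply: cauchyH_mu0; rewrite /= (lt_le_trans _ y1). Qed.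

Lemma flow_Im s y : 0 <= s -> 1 <= y -> y <= complex.Im (H s y).
Proof. by move=> _ y1; exact: ImH_iy_ge. Qed.

(** [E] appears in closed form because the passage from mu to tau relies on its sign as well as on
    its size. *)
Lemma generator_decomposition j : intgt (fun x => x ^+ (2 * j.+1)) ->
  let E w := - (w^-1 ^+ (2 * j).+1 *
    cauchyT tau (fun x => x * (x ^+ (2 * j) * (1 + x ^+ 2))) w) in
  exists P C, (forall w, 1 <= complex.Im w -> A w = evr P w^-1 + E w) /\
    (forall w, 1 <= complex.Im w -> nc (E w) <= C * (complex.Im w)^-1 ^+ (2 * j).+1).
Proof.
move=> ij E; have [P hP] := generatorA_taylor gamma ij.
have fE : (fun x : R => x ^+ (2 * j).+1 * (1 + x ^+ 2)) =
    (fun x => x * (x ^+ (2 * j) * (1 + x ^+ 2))).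
  by apply/funext => x; rewrite exprS mulrA.
have [C hC] := cauchyT_remainder (intg_weight ij (leqnn (2 * j))).
rewrite fE in hC; exists P, C; split=> w w1; have w0 := lt_le_trans ltr01 w1.
  by rewrite hP// fE.
by rewrite ncN; exact: hC.
Qed.

(** The flow on [0, t] has an expansion of order 2j + 1; frozen at time t, it is the one that
    [H_expands_moment] converts into a moment. *)
Lemma tau_moment_mu_moment j : intgt (fun x => x ^+ (2 * j.+1)) ->
  forall t, 0 < t -> (mu t).-integrable setT (EFin \o (fun x : R => x ^+ (2 * j.+1))).
Proof.
move=> ij t t0; have [P [C [AE EC]]] := generator_decomposition ij.
apply: (@H_expands_moment _ _ t); first exact: ltW.
have := flow_expands (T := t) flow_at0 (fun y y1 => flow_continuous t y1)
  flow_derive flow_Im AE EC.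
by move=> /(@expands_freeze _ t _ _ t); apply; rewrite lexx ltW.
Qed.

(** The integral of 1/(1 + x^2) against mu_s is continuous in s and equals 1 at s = 0, so it stays
    above 1/2 for small s; [ncH_iy_le] concludes. *)
Lemma short_time_bound : exists2 d, 0 < d & forall s y, 0 <= s <= d -> 1 <= y ->
  nc (H s y) <= 2 * y.
Proof.
pose f (x : R) := 1 ^+ 2 / (x ^+ 2 + 1 ^+ 2) : R.
have q0 (x : R) : 0 < x ^+ 2 + 1 ^+ 2 by rewrite ltr_wpDl ?sqr_ge0// exprn_gt0.
have fc : continuous f.
  move=> x; apply: cvgM; first exact: cvg_cst.
  apply: cvgV; first by rewrite gt_eqF.
  by apply: cvgD; [exact: exprn_continuous|exact: cvg_cst].
have fb : exists M, forall x, `|f x| <= M.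
  exists 1 => x; have /andP[? ?] := cutoff_ge0_le1 x (ltr01 : 0 < 1 :> R).
  by rewrite ger0_norm.
pose K t := Rintegral (mu t) setT f.
have K0 : K 0 = 1.
  rewrite /K Rintegral_mu0 /f; last exact: continuous_measurable_fun.
  by rewrite expr0n /= add0r expr1n divr1.
have /subspace_continuousP/(_ 0 (lexx _)) := mu_wc fc fb.
have h12 : 0 < 1 / 2 :> R by rewrite divr_gt0.
move=> /cvgrPdist_le /(_ _ h12) /nbhs_ballP[d /= d0 hd]; exists (d / 2); first by rewrite divr_gt0.
move=> s y /andP[s0 sd] y1.
have Ks : 1 / 2 <= K s.
  have : `|K 0 - K s| <= 1 / 2.
    apply: hd => //; rewrite /ball /= sub0r normrN ger0_norm//.
    by rewrite (le_lt_trans sd)// ltr_pdivrMr// ltr_pMr// ltr1n.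
  by rewrite K0 ler_norml => /andP[_]; lra.
have [_ /le_trans] := ncH_iy_le (mu s) y1; apply.
have k0 := cutoff_integral_gt0 (mu s).
have Ks' : 1 / 2 <= Rintegral (mu s) setT (fun x => 1 ^+ 2 / (x ^+ 2 + 1 ^+ 2)) by exact: Ks.
rewrite ler_pdivrMr// mulrAC ler_peMl//; first by rewrite (le_trans ler01).
by lra.
Qed.

(** The coefficient of order 0 is real, so it does not contribute to the imaginary part. *)
Lemma expands1_Im (T : R) F : expands T 1 F -> exists C, forall s y,
  0 <= s <= T -> 1 <= y -> `|complex.Im (F s y)| <= C / y.
Proof.
move=> [p [C hC]]; elim/poly_ind: p hC => [|p c _] hC.
  exists C => s y sT y1; have := hC s y sT y1.
  by rewrite /ev rmorph0 horner0 subr0 expr1; exact: le_trans (nc_ge_Im _).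
have [D D0 hD] := ev_bounded T p.
exists (C + D) => s y sT y1; have y0 : 0 < y by rewrite (lt_le_trans _ y1).
have := hC s y sT y1; rewrite evD evM evX evC expr1.
set v := ev _ _ _ * _; set a := F s y => h.
have -> : complex.Im a = complex.Im (a - (v + real_complex R c.[s])) + complex.Im v.
  by rewrite cImD cImN cImD /= addr0 subrK.
rewrite (le_trans (ler_normD _ _))// mulrDl lerD//.
  exact: le_trans (nc_ge_Im _) h.
rewrite (le_trans (nc_ge_Im _))// ncM nc_iyV ?(ltW y0)// ler_wpM2r ?invr_ge0 ?(ltW y0)//.
exact: hD.
Qed.

(* Im H_d <= Im H_t0 by the semigroup property, so that int_0^d Im A(H_s(iy)) ds = O(1/y),
   while Im A(H_s(iy)) >= Q(y)/(8y) where Q(y) increases to int (1 + x^2) dtau. *)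
Lemma mu_tau_second_moment t0 : 0 < t0 ->
  (mu t0).-integrable setT (EFin \o (fun x : R => x ^+ (2 * 1))) ->
  intgt (fun x => x ^+ (2 * 1)).
Proof.
move=> t00 i2; have [C hC] := expands1_Im (moment_H_expands t0 i2).
have [d1 d10 hd1] := short_time_bound.
(* d <= d1 gives |H_s(iy)| <= 2 y up to time d; d <= t0 allows the splitting t0 = (t0 - d) + d. *)
pose d := Num.min d1 t0.
have d0 : 0 < d by rewrite lt_min d10.
have dd1 : d <= d1 by rewrite ge_min lexx.
have dt0 : d <= t0 by rewrite ge_min lexx orbT.
pose G (x : R) := 1 + x ^+ 2.
suff iG : intgt G.
  apply: (intg_le _ _ iG); first exact: exprn_measurable.
  by move=> x; rewrite muln1 ger0_norm ?sqr_ge0// lerDr.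
pose Q k := Rintegral tau setT (fun x => G x * (k.+1%:R ^+ 2 / (x ^+ 2 + k.+1%:R ^+ 2))).
apply: (@integrable_fatou _ _ _ (8 * C / d) 0).
- by move=> x; rewrite addr_ge0// sqr_ge0.
- by apply: measurable_funD => //; exact: exprn_measurable.
- move=> k; have y0 : 0 < k.+1%:R :> R by rewrite ltr0n.
  rewrite (_ : (fun x => _) = fun x => k.+1%:R ^+ 2 / (x ^+ 2 + k.+1%:R ^+ 2) +
     x ^+ 2 * cst 1 x * (k.+1%:R ^+ 2 / (x ^+ 2 + k.+1%:R ^+ 2))).
    apply: intgD; last exact/intg_cutoff/tau_intg_cst.
    apply: (intg_le _ _ (tau_intg_cst tau 1)); first exact: measurable_cutoff.
    by move=> x; have /andP[? ?] := cutoff_ge0_le1 x y0; rewrite ger0_norm.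
  by apply/funext => x; rewrite /G mulr1 mulrDl mul1r.
move=> k _; rewrite -/(Q k); have y1 : 1 <= k.+1%:R :> R by rewrite ler1n.
(* The expanded function is H at time t0 whatever the time argument; 0 is merely an admissible
   value. *)
have := hC 0 k.+1%:R; rewrite lexx (ltW t00) => /(_ isT y1).
rewrite /Q; set y : R := k.+1%:R in y1 *; set q := Rintegral _ _ _ => hy.
have y0 : 0 < y by rewrite (lt_le_trans _ y1).
have h1 : complex.Im (H d y) <= complex.Im (H t0 y).
  have -> : t0 = (t0 - d) + d by rewrite subrK.
  rewrite mu_sg ?subr_ge0 ?(ltW d0)//.
  have hd := flow_Im (ltW d0) y1.
  apply: ImH_ge; first exact: lt_le_trans y0 hd.
  (* [ImH_ge] asks that the Cauchy transform of [mu (t0 - d)] not vanish at H_d(iy). Its inverse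
     there is H_t0(iy), which is nonzero, and the inverse of 0 is 0. *)
  have : cauchyH (mu t0) (iy y) != 0 by rewrite invr_eq0; have [] := ncH_iy_le (mu t0) y1.
  have {1}-> : t0 = (t0 - d) + d by rewrite subrK.
  by rewrite mu_sg ?subr_ge0 ?(ltW d0)//= invr_eq0.
have h2 : (8 * y)^-1 * q * d <= complex.Im (H d y) - y.
  have dlow s : 0 < s < d -> - complex.Im (A (H s y)) <= - ((8 * y)^-1 * q).
    move=> /andP[s0 sd]; rewrite lerN2; apply: ImA_lower => //.
      exact/flow_Im/y1/ltW.
    by apply: hd1 => //; rewrite (ltW s0) (le_trans (ltW sd)).
  have [_ c2] := flow_continuous d y1.
  have dd s : 0 < s < d -> is_derive s 1 (fun s => - complex.Im (H s y))
      (- complex.Im (A (H s y))).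
    move=> /andP[s0 _]; apply: (is_deriveN (f := fun s => complex.Im (H s y))).
    by have [] := flow_derive s0 y1.
  have cc : {within `[0, d], continuous (fun s => - complex.Im (H s y))}.
    by move=> x; apply: cvgN; exact: c2.
  have := le_of_derive (ltW d0) dd cc dlow.
  by rewrite (flow_at0 y1) opprK mulNr lerNr opprD opprK.
have h3 : complex.Im (H t0 y) - y <= C / y.
  by rewrite (le_trans _ hy)// (le_trans _ (ler_norm _))// cImD cImN.
have : (8 * y)^-1 * q * d <= C / y by rewrite (le_trans h2)// (le_trans _ h3)// lerD2r.
have -> : (8 * y)^-1 * q * d = (q * d / 8) / y by field; rewrite gt_eqF.
rewrite ler_pM2r ?invr_gt0// ler_pdivlMr// => h; lra.
Qed.

(* D = H - iy - q is O(y^-(N+2)) up to a real polynomial at s = t0, while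
   Re ((iy)^(N+2) dD/ds) <= O(1) - Q(y)/40 with Q(y) increasing to int x^2 g dtau. *)
Lemma mu_tau_moment_step t0 j : 0 < t0 ->
  intgt (fun x => x ^+ (2 * j.+1)) ->
  (mu t0).-integrable setT (EFin \o (fun x : R => x ^+ (2 * j.+2))) ->
  intgt (fun x => x ^+ (2 * j.+2)).
Proof.
move=> t00 ij imu; have [P [C [AE EC]]] := generator_decomposition ij.
set E := (E in forall w, _ -> A w = evr P w^-1 + E w) in AE EC.
pose g (x : R) := x ^+ (2 * j) * (1 + x ^+ 2).
pose N := (2 * j).+1.
have ig : intgt g := intg_weight ij (leqnn (2 * j)).
have g0 x : 0 <= g x.
  by rewrite mulr_ge0 ?addr_ge0 ?sqr_ge0// exprM exprn_ge0// sqr_ge0.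
have t0T : 0 <= t0 <= t0 by rewrite lexx ltW.
have fc y y1 := @flow_continuous t0 y y1.
have hH := flow_expands (T := t0) flow_at0 fc flow_derive flow_Im AE EC.
(* Order N for H - iy becomes N + 2 for the regular part, so its replacement error stays bounded
   after multiplication by (iy)^(N+2). *)
have hP := flow_inv_expands P flow_Im hH.
have [q [C' [C'0 q0 Dc Dd]]] := flow_primitive fc flow_derive flow_Im AE hP.
pose D s y := H s y - iy y - ev q s (iy y)^-1.
have D0 y : 1 <= y -> D 0 y = 0.
  by move=> y1; rewrite /D flow_at0// subrr q0 subrr.
have [B B0 hB] := expands_bounded hH.
have wB s y : 0 < s < t0 -> 1 <= y -> nc (H s y - iy y) <= B.
  by move=> /andP[s0 sT] y1; apply: hB => //; rewrite (ltW s0) ltW.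
pose dD y s := xget 0 [set d | cderiv (D ^~ y) s d /\
  nc (d - E (H s y)) <= C' * y^-1 ^+ N.+2].
have hdD y s : 1 <= y -> 0 < s < t0 -> cderiv (D ^~ y) s (dD y s) /\
    nc (dD y s - E (H s y)) <= C' * y^-1 ^+ N.+2.
  move=> y1 /andP[s0 sT].
  have [|e ee ed] := Dd s y _ y1; first by rewrite s0 ltW.
  apply: (@xgetPex _ 0 [set d | cderiv (D ^~ y) s d /\
    nc (d - E (H s y)) <= C' * y^-1 ^+ N.+2]).
  by exists (E (H s y) + e); split => //; rewrite addrAC subrr add0r.
(* The moment of order 2j + 4 of mu at t0 gives an expansion of order 2j + 3 = N + 2. *)
have hDexp : expands t0 N.+2 (fun _ => D t0).
  have e1 : expands t0 N.+2 (fun _ y => cauchyH (mu t0) (iy y) - iy y).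
    have := moment_H_expands t0 imu.
    by rewrite /N mulnS add2n.
  have e2 := expands_freeze (expands_ev t0 N.+2 q) t0T.
  exact: expandsD e1 (expandsN e2).
have small e : 0 < e -> exists k0, forall k, (k0 <= k)%N ->
    nc (D t0 k.+1%:R) <= e * k.+1%:R^-1 ^+ N.
  (* [E] and the replacement error each receive e/(4 t0); their sum is multiplied by 2 t0 in
     [nc_le_of_derive], which gives e. *)
  move=> e0; have e4 : 0 < e / (4 * t0) by rewrite divr_gt0// mulr_gt0.
  have B1 : 0 <= 1 + B by rewrite addr_ge0.
  have [k1 h1] := cauchyT_small ig B1 e4.
  have [k2 h2] := harmonic_small C' e4.
  exists (maxn k1 k2) => k; rewrite geq_max => /andP[kk1 kk2].
  have y1 : 1 <= k.+1%:R :> R by rewrite ler1n.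
  have {}h1 := h1 k kk1; have {}h2 := h2 k kk2.
  set y : R := k.+1%:R in y1 h1 h2 *; have y0 : 0 < y by rewrite (lt_le_trans _ y1).
  have y0' := ltW y0; have yV : 0 <= y^-1 by rewrite invr_ge0.
  have bound s : 0 < s < t0 -> nc (dD y s) <= e / (2 * t0) * y^-1 ^+ N.
    move=> sT; have [_ hd] := hdD y s y1 sT; have /andP[s0 sT'] := sT.
    rewrite -[dD y s](subrK (E (H s y))) (le_trans (ncD _ _))//.
    have -> : e / (2 * t0) = e / (4 * t0) + e / (4 * t0).
      by field; rewrite gt_eqF.
    rewrite [leRHS]mulrDl lerD//.
      rewrite (le_trans hd)// exprS [y^-1 ^+ N.+1]exprS !mulrA ler_wpM2r ?exprn_ge0//.
      apply: le_trans _ h2; apply: ler_piMr; first by rewrite mulr_ge0.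
      by rewrite invf_le1.
    rewrite /E ncN ncM ncX mulrC ler_pM ?nc_ge0 ?exprn_ge0 ?nc_ge0//.
      apply: h1; first exact/flow_Im/y1/ltW.
      rewrite -[cauchyH _ _](subrK (iy y)) (le_trans (ncD _ _))// nc_iy// mulrDl mul1r.
      by rewrite addrC lerD2l (le_trans (wB s y sT y1))// ler_peMr.
    rewrite lerXn2r ?nnegrE ?nc_ge0//.
    exact: (flow_ncV flow_Im (ltW s0) y1).
  have := nc_le_of_derive (ltW t00) (fun s sT => (hdD y s y1 sT).1) (Dc y y1) bound.
  rewrite -/(D t0 y) -/(D 0 y) D0// subr0 => /le_trans; apply.
  by rewrite le_eqVlt; apply/orP; left; apply/eqP; field; rewrite !gt_eqF.
have [M hM] := expands_Re_bounded hDexp t0T small.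
have [L [y0 [L0 y01 hL]]] := cauchyT_lower N g0 ig B0.
have ix2 : intgt (fun x => x ^+ 2 * g x).
  (* Solves - M <= (- (r/40 - L) + C') t0 for the truncated integral r: the left side bounds the
     real part of (iy)^(N+2) D at t0 from below, the right side from above. *)
  apply: (@integrable_fatou _ _ _ (40 * (M / t0 + L + C')) (Num.bound y0)).
  - by move=> x; rewrite mulr_ge0 ?sqr_ge0.
  - apply: measurable_funM; first exact: exprn_measurable.
    exact: (intg_measurable ig).
  - by move=> k; apply: intg_cutoff => //; rewrite ltr0n.
  move=> k kk0; have y1 : 1 <= k.+1%:R :> R by rewrite ler1n.
  have yy0 : y0 <= k.+1%:R.
    rewrite (le_trans (ltW (archi_boundP _)))//; first by rewrite (le_trans ler01).
    by rewrite ler_nat (leq_trans kk0).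
  have {}hL w := hL _ w yy0; have := hM k.
  set y : R := k.+1%:R in y1 yy0 hL *; have y0' : 0 < y by rewrite (lt_le_trans _ y1).
  set r := Rintegral _ _ _ in hL *.
  pose z := iy y ^+ N.+2.
  have dlow s : 0 < s < t0 -> complex.Re (z * dD y s) <= - (40^-1 * r - L) + C'.
    move=> sT; have [_ hd] := hdD y s y1 sT; have /andP[s0 _] := sT.
    rewrite -[dD y s](subrK (E (H s y))) addrC mulrDr cReD lerD//.
      have := hL _ (flow_Im (ltW s0) y1) (wB s y sT y1).
      by rewrite /E mulrN cReN lerN2.
    rewrite (le_trans (ler_norm _))// (le_trans (nc_ge_Re _))// ncM ncX nc_iy ?(ltW y0')//.
    by rewrite mulrC -ler_pdivlMr ?exprn_gt0// -exprVn.
  have [c1 c2] := Dc y y1.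
  have := @le_of_derive _ (fun s => complex.Re (z * D s y)) _ _ t0 (ltW t00) _ _ dlow.
  rewrite D0// mulr0 subr0 => h hMk.
  have {h} : complex.Re (z * D t0 y) <= (- (40^-1 * r - L) + C') * t0.
    apply: h => [s sT|]; first by have [] := cderivMl z (hdD y s y1 sT).1.
    rewrite (_ : (fun s => _) = fun s => complex.Re z * complex.Re (D s y)
      - complex.Im z * complex.Im (D s y)); last by apply/funext => s; rewrite cReM.
    by move=> x; apply: cvgB; apply: cvgM; [exact: cvg_cst|exact: c1|exact: cvg_cst|exact: c2].
  move: hMk; rewrite -/z ler_norml => /andP[hMk _] h.
  have : - M / t0 <= - (40^-1 * r - L) + C' by rewrite ler_pdivrMr// (le_trans hMk).
  by rewrite mulNr; lra.
(* Here x^2 g = x^(2j+2) + x^(2j+4), which dominates the wanted power. *)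
apply: (intg_le _ _ ix2); first exact: exprn_measurable.
move=> x; rewrite ger0_norm; last by rewrite exprM exprn_ge0// sqr_ge0.
rewrite 2!mulnS 2!exprD ler_wpM2l ?sqr_ge0// mulrC ler_wpM2l//; last by rewrite lerDr.
by rewrite exprM exprn_ge0// sqr_ge0.
Qed.

(** Each step needs the previous even moment of tau; induction supplies it because mu at t0 also has
    the lower moment. *)
Lemma mu_tau_moment t0 j : 0 < t0 ->
  (mu t0).-integrable setT (EFin \o (fun x : R => x ^+ (2 * j.+1))) ->
  intgt (fun x => x ^+ (2 * j.+1)).
Proof.
move=> t00; elim: j => [|j ih] imu; first exact: mu_tau_second_moment imu.
apply: mu_tau_moment_step (imu) => //; apply: ih.
by apply: intg_moment_le imu _; rewrite leq_mul2l /= leqW.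
Qed.

End Semigroup.

Theorem theorem6p8 (R : realType) (mu : R -> probability R R) (gamma : R)
    (tau : {finite_measure set R -> \bar R}) (n : nat) :
  (1 <= n)%N ->
  weakly_continuous mu ->
  (forall A : set R, measurable A -> mu 0 A = \d_(0 : R) A) ->
  monotone_semigroup mu ->
  associated_pair mu gamma tau ->
  ((exists t0 : R, 0 < t0 /\ (\int[mu t0]_x ((x ^+ (2 * n))%:E) < +oo)%E)
     <-> (forall t : R, 0 < t -> (\int[mu t]_x ((x ^+ (2 * n))%:E) < +oo)%E))
  /\
  ((forall t : R, 0 < t -> (\int[mu t]_x ((x ^+ (2 * n))%:E) < +oo)%E)
     <-> (\int[tau]_x ((x ^+ (2 * n))%:E) < +oo)%E).
Proof.
case: n => [//|n] _ wc mu0 sg gen.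
(* A single time suffices for (1) => (3); with (3) => (2), and (2) => (1) at time 1, the cycle
   closes. *)
have mom_tau t0 : 0 < t0 -> (\int[mu t0]_x ((x ^+ (2 * n.+1))%:E) < +oo)%E ->
    (\int[tau]_x ((x ^+ (2 * n.+1))%:E) < +oo)%E.
  move=> t00 /moment_integrableP it0; apply/moment_integrableP.
  exact: (mu_tau_moment wc mu0 sg gen t00 it0).
have tau_mom : (\int[tau]_x ((x ^+ (2 * n.+1))%:E) < +oo)%E ->
    forall t, 0 < t -> (\int[mu t]_x ((x ^+ (2 * n.+1))%:E) < +oo)%E.
  move=> /moment_integrableP it t t0; apply/moment_integrableP.
  exact: (tau_moment_mu_moment wc mu0 gen it t0).
split; split.
- by move=> [t0 [t00 /(mom_tau t0 t00)]]; exact: tau_mom.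
- by move=> h; exists 1; split=> //; exact: h.
- by move=> h; exact: (mom_tau 1 ltr01 (h 1 ltr01)).
- exact: tau_mom.
Qed.
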